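(* Let $\alpha,\beta,\nu_1,\nu_2>0$ satisfy $$\frac{\nu_1}{\beta\nu_2\lambda_2(\mathsf{L}+\mathsf{L}^\top)}+\frac{\nu_2^2\,\lambda_{\max}(\mathsf{L}^\top\mathsf{L})}{2\alpha}<\lambda_2(\mathsf{L}+\mathsf{L}^\top).$$ Then every trajectory $t\mapsto(P(t),z(t),v(t))$ of the differential inclusion $$\dot P\in-\mathsf{L}\,\partial f^\epsilon(P)+\nu_1 z,\qquad \dot z=-\alpha z-\beta\mathsf{L}z-v+\nu_2(P_le_r-P),\qquad \dot v=\alpha\beta\mathsf{L}z,$$ starting from any point in $\mathbb{R}^n\times\mathbb{R}^n\times\mathcal{H}_0$, converges (as $t\to\infty$) to the set $$\mathcal{F}_{\mathrm{aug}}^*=\{(P,z,v)\in\mathcal{F}_{\mathrm{ED}}^*\times\{0\}\times\mathbb{R}^n \mid v=\nu_2(P_le_r-P)\}.$$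
   Context: Notation: $\mathbf{1}_n=(1,\dots,1)\in\mathbb{R}^n$; $[u]^+=\max\{0,u\}$; vector inequalities are componentwise; $\|\cdot\|_\infty$ is the $\infty$-norm; $\mathcal{H}_s=\{x\in\mathbb{R}^n\mid\mathbf{1}_n^\top x=s\}$ for $s\in\mathbb{R}$; $e_r\in\mathbb{R}^n$ is the $r$-th canonical unit vector, where $r\in\{1,\dots,n\}$ is a fixed (arbitrary) index, the only unit that knows $P_l$. Graph. $\mathcal{G}=(\mathcal{V},\mathcal{E},\mathsf{A})$ is a weighted digraph with $\mathcal{V}=\{1,\dots,n\}$ and adjacency matrix $\mathsf{A}=(a_{ij})\in\mathbb{R}_{\ge0}^{n\times n}$, with $a_{ij}>0$ iff $(i,j)\in\mathcal{E}$. Its Laplacian is $\mathsf{L}=\mathsf{D}_{\rm out}-\mathsf{A}$, where $\mathsf{D}_{\rm out}$ is diagonal with $(\mathsf{D}_{\rm out})_{ii}=\sum_j a_{ij}$. $\mathcal{G}$ is assumed strongly connected and weight-balanced (i.e., $\sum_j a_{ij}=\sum_j a_{ji}$ for all $i$, equivalently $\mathbf{1}_n^\top\mathsf{L}=0$). $\lambda_2(\mathsf{L}+\mathsf{L}^\top)$ is the smallest nonzero eigenvalue of $\mathsf{L}+\mathsf{L}^\top$, and $\lambda_{\max}$ denotes the maximum eigenvalue of a symmetric matrix. Economic dispatch (ED) problem. $f_i:\mathbb{R}\to\mathbb{R}_{\ge0}$, $i\in\{1,\dots,n\}$, are convex and continuously differentiable; $f(P)=\sum_{i=1}^n f_i(P_i)$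 for $P\in\mathbb{R}^n$; $P_l\in\mathbb{R}_{>0}$ is the load; $P^m,P^M\in\mathbb{R}^n$ are the lower and upper limits. The feasible set is $\mathcal{F}_{\mathrm{ED}}=\{P\in\mathbb{R}^n \mid P^m\le P\le P^M,\ \mathbf{1}_n^\top P=P_l\}$, assumed nonempty, and $\mathcal{F}_{\mathrm{ED}}^*$ is the set of minimizers of $f$ over $\mathcal{F}_{\mathrm{ED}}$. It is assumed that $P^m\notin\mathcal{F}_{\mathrm{ED}}$ and $P^M\notin\mathcal{F}_{\mathrm{ED}}$. Penalized cost. $f^{\epsilon}(P)=\sum_{i=1}^n f_i(P_i)+\frac1\epsilon\sum_{i=1}^n\big([P_i-P_i^M]^+ + [P_i^m-P_i]^+\big)$, where $\epsilon>0$ satisfies $\epsilon<\dfrac{1}{2\max_{P\in\mathcal{F}_{\mathrm{ED}}}\|\nabla f(P)\|_\infty}$. $\partial f^\epsilon$ denotes the (Clarke) generalized gradient, and $-\mathsf{L}\,\partial f^\epsilon(P)=\{-\mathsf{L}\zeta\mid\zeta\in\partial f^\epsilon(P)\}$. Trajectories are solutions of the differential inclusion on $[0,\infty)$, i.e., locally absolutely continuous maps satisfying it for almost all $t\ge0$. Convergence to a set means that the distance to the set tends to $0$. *)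

(* Defs.v *)
From HB Require Import structures.
From mathcomp Require Import all_boot all_order all_algebra.
From mathcomp Require Import all_classical all_reals all_analysis.

Set Implicit Arguments.
Unset Strict Implicit.
Unset Printing Implicit Defensive.

Import Order.TTheory GRing.Theory Num.Theory.
Import numFieldNormedType.Exports.

Local Open Scope classical_set_scope.
Local Open Scope ring_scope.

(* Vectors of R^n are column vectors 'cV[R]_n. The library norm on 'cV[R]_n is
   the maximum of the absolute values of the entries, i.e. the infinity norm. *)

Section Digraph.
Variables (R : realType) (n : nat).
Implicit Types (A M : 'M[R]_n).

(* a_ij > 0 iff (i, j) is an edge, so the edge set is read off from A. *)
Definition edge A : rel 'I_n := fun i j => 0 < A i j.

Definition strongly_connected A := forall i j : 'I_n, connect (edge A) i j.

Definition weight_balanced A :=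
  forall i : 'I_n, \sum_j A i j = \sum_j A j i.

Definition out_degree A : 'rV[R]_n := \row_i \sum_j A i j.

Definition laplacian A : 'M[R]_n := diag_mx (out_degree A) - A.

(* The spectrum is finite, so inf and sup below are a minimum and a maximum as
   soon as the sets are nonempty. [lambda2] is only meaningful if there is a
   nonzero eigenvalue; otherwise it is inf set0 = 0. *)
Definition lambda2 M : R := inf [set l : R | eigenvalue M l /\ l != 0].

Definition lambda_max M : R := sup [set l : R | eigenvalue M l].

End Digraph.

Section Gradients.
Variables (R : realType) (n : nat).
Implicit Types (g : 'cV[R]_n -> R) (x d zeta : 'cV[R]_n).

Definition dotp x d : R := \sum_i x i 0 * d i 0.

Definition gradient g x : 'cV[R]_n := \col_i 'D_(delta_mx i 0) g x.

(* Clarke's generalized directional derivative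
   g°(x; d) = limsup_{y -> x, h -> 0+} (g (y + h d) - g y) / h,
   and his generalized gradient {zeta | <zeta, d> <= g°(x; d) for all d}. *)
Definition clarke_dderiv g x d : \bar R :=
  limf_esup (fun yh : 'cV[R]_n * R =>
      ((g (yh.1 + yh.2 *: d) - g yh.1) / yh.2)%:E)
    (filter_prod (nbhs x) (0 : R)^'+).

Definition clarke_gradient g x : set 'cV[R]_n :=
  [set zeta | forall d, ((dotp zeta d)%:E <= clarke_dderiv g x d)%E].

End Gradients.

Section AbsoluteContinuity.
Variables (R : realType) (V : normedModType R).

(* A pair u stands for the interval [u.1, u.2]; the intervals of s are required
   to be pairwise non-overlapping. *)
Definition abs_continuous_on (a b : R) (x : R -> V) :=
  forall e : R, 0 < e -> exists2 d : R, 0 < d &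
    forall s : seq (R * R),
      all (fun u => (a <= u.1) && (u.1 <= u.2) && (u.2 <= b)) s ->
      pairwise (fun u w => (u.2 <= w.1) || (w.2 <= u.1)) s ->
      \sum_(u <- s) (u.2 - u.1) < d ->
      \sum_(u <- s) `|x u.2 - x u.1| < e.

Definition locally_abs_continuous (x : R -> V) :=
  forall T : R, 0 <= T -> abs_continuous_on 0 T x.

End AbsoluteContinuity.

Section EconomicDispatch.
Variables (R : realType) (n : nat).
Variables (f : 'I_n -> R -> R) (Pl : R) (Pm PM : 'cV[R]_n).

Definition C1_function (g : R -> R) :=
  (forall x, derivable g x 1) /\ continuous (derive1 g).

Definition total_cost (P : 'cV[R]_n) : R := \sum_i f i (P i 0).

Definition ED_feasible : set 'cV[R]_n :=
  [set P | (forall i, Pm i 0 <= P i 0 <= PM i 0) /\ \sum_i P i 0 = Pl].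

Definition ED_solutions : set 'cV[R]_n :=
  [set P | ED_feasible P /\
    forall Q, ED_feasible Q -> total_cost P <= total_cost Q].

(* max of |grad f|_oo over the feasible set; it is attained when the f i are C1
   and the feasible set, which is compact, is nonempty *)
Definition max_gradient_norm : R :=
  sup [set `|gradient total_cost P| | P in ED_feasible].

Definition penalized_cost (eps : R) (P : 'cV[R]_n) : R :=
  \sum_i f i (P i 0) +
  eps^-1 * \sum_i (Num.max 0 (P i 0 - PM i 0) + Num.max 0 (Pm i 0 - P i 0)).

End EconomicDispatch.

Section Dynamics.
Variables (R : realType) (n : nat).
Variables (L : 'M[R]_n) (f : 'I_n -> R -> R).
Variables (Pl : R) (Pm PM : 'cV[R]_n) (eps : R) (r : 'I_n).
Variables (alpha beta nu1 nu2 : R).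

Definition mismatch (P : 'cV[R]_n) : 'cV[R]_n :=
  nu2 *: (Pl *: delta_mx r 0 - P).

(* Only the values of P, z, v on [0, +oo[ are constrained. *)
Definition trajectory (P z v : R -> 'cV[R]_n) :=
  [/\ locally_abs_continuous P,
      locally_abs_continuous z,
      locally_abs_continuous v &
      {ae (@lebesgue_measure R), forall t : R, 0 <= t ->
        [/\ derivable P t 1, derivable z t 1 & derivable v t 1] /\
        [/\ [set - (L *m zeta) + nu1 *: z t |
               zeta in clarke_gradient (penalized_cost f Pm PM eps) (P t)]
              (derive1 P t),
            derive1 z t = - (alpha *: z t) - beta *: (L *m z t) - v t
                      + mismatch (P t) &
            derive1 v t = (alpha * beta) *: (L *m z t)]}].

Definition F_aug : set ('cV[R]_n * 'cV[R]_n * 'cV[R]_n) :=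
  [set x | [/\ ED_solutions f Pl Pm PM x.1.1,
               x.1.2 = 0 &
               x.2 = mismatch x.1.1]].

End Dynamics.

(* Main.v *)
(* Put w = v - nu2 (Pl e_r - P) + alpha z. For zeta in the generalized gradient at
   P the system reads P' = - L zeta + nu1 z, z' = - beta L z - w,
   w' = - alpha w - nu2 L zeta + nu1 nu2 z, and along it
   V = f^eps(P) + (nu1 nu2 |z|^2 + |w|^2) / 2 satisfies, by Young's inequality and
   the condition on the gains,
     V' <= - c (|zeta~|^2 + |z|^2 + |w|^2) + C exp(- k t),
   where zeta~ is zeta minus its mean. The error term comes from the sums of P - Pl
   and z, which solve a damped linear oscillator; the mean of zeta multiplying it is
   bounded by a constant plus |zeta~| because the sum of P is bounded. Hence V, P, z,
   w are bounded and Lipschitz, and Barbalat's argument gives z -> 0, w -> 0 and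
   f^eps(P) - f^* -> 0 from above, since convexity bounds this gap by |zeta~| up to a
   decaying term. Exactness of the penalty and compactness conclude.

   No chain rule for f^eps is needed: zeta . P' bounds the left Dini derivative of
   f^eps(P), and an absolutely continuous function whose left Dini derivative is
   almost everywhere nonpositive is nonincreasing. *)
Require Import Defs.
From mathcomp Require Import all_boot all_order all_algebra.
From mathcomp Require Import all_classical all_reals all_analysis.
From mathcomp Require Import ring lra.
Set Implicit Arguments.
Unset Strict Implicit.
Unset Printing Implicit Defensive.

Import Order.TTheory GRing.Theory Num.Theory.
Import numFieldNormedType.Exports.
Local Open Scope classical_set_scope.
Local Open Scope ring_scope.

(** * Absolutely continuous functions and differential inequalities *)

(** The left side is imposed by convexity: if zeta is a subgradient of f^eps at P(t), then
    f^eps(P(t)) - f^eps(P(s)) <= zeta . (P(t) - P(s)) for every s, which bounds the difference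
    quotient from above for s < t and from below for s > t. This inequality is all that is used of
    the generalized gradient: no semicontinuity and no invariance principle for inclusions comes in.
    The term alpha z in w answers v' = alpha beta L z: then v' + alpha z' = - alpha w, which damps
    w. What remains to absorb is nu1 zeta~ . z~ - nu2 w . L zeta~, with z~ the centered z, against
    lambda2 |zeta~|^2 / 2, nu1 nu2 beta lambda2 |z~|^2 / 2 and alpha |w|^2. With the best weights,
    Young's inequality costs half the left side of the gain condition times |zeta~|^2; this is where
    that condition comes from. V contains the cost itself, not a distance to an optimum. It is
    bounded below because the f_i are nonnegative, and it confines P because the penalty grows
    linearly outside the box. *)

Section LeftDini.
Context {R : realType}.
Implicit Types (x y : R -> R) (t c D : R).

(** The slack [e] replaces a limsup, so that bounds can be added and compared without any limit
    having to exist. *)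
Definition left_dini_le x t D :=
  forall e, 0 < e -> \forall s \near t^'-, x t - x s <= (D + e) * (t - s).

Lemma left_dini_leW x t c D : c <= D -> left_dini_le x t c -> left_dini_le x t D.
Proof.
move=> cD xc e e0; near=> s.
have st : s < t by near: s; exact: nbhs_left_lt.
have h : x t - x s <= (c + e) * (t - s) by near: s; exact: xc.
by apply: le_trans h _; rewrite ler_pM2r ?subr_gt0// lerD2r.
Unshelve. all: by end_near. Qed.

Lemma left_dini_leD x y t c D : left_dini_le x t c -> left_dini_le y t D ->
  left_dini_le (x \+ y) t (c + D).
Proof.
move=> xc yD e e0; near=> s.
have h1 : x t - x s <= (c + e / 2) * (t - s) by near: s; apply: xc; lra.
have h2 : y t - y s <= (D + e / 2) * (t - s) by near: s; apply: yD; lra.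
by rewrite /=; nra.
Unshelve. all: by end_near. Qed.

Lemma is_derive_left_dini x t D : is_derive t 1 x D -> left_dini_le x t D.
Proof.
move=> xD e e0.
have [dx dE] := xD.
have /cvgrPdist_le /(_ e e0) : h^-1 *: (x (h *: 1 + t) - x t) @[h --> 0^'] --> D.
  by rewrite -dE; exact: dx.
move=> [d /= d0 hd]; near=> s.
have st : s < t by near: s; exact: nbhs_left_lt.
have sd : t - d < s by near: s; apply: nbhs_left_gt; rewrite ltrBlDr ltrDl.
have := hd (s - t); rewrite /ball_ /= sub0r opprB.
rewrite gtr0_norm ?subr_gt0// => /(_ ltac:(lra) ltac:(rewrite subr_eq0; lra)).
rewrite /GRing.scale/= mulr1 subrK => /ler_normlP[+ _].
rewrite -(ler_pM2r (_ : 0 < t - s)) ?subr_gt0//.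
have ne : s - t != 0 by rewrite subr_eq0; lra.
have -> : - (D - (s - t)^-1 * (x s - x t)) * (t - s) = x t - x s - D * (t - s).
  by field.
by lra.
Unshelve. all: by end_near. Qed.

Lemma left_dini_le_dominated x y t D :
  (forall s, s < t -> x t - x s <= y t - y s) ->
  left_dini_le y t D -> left_dini_le x t D.
Proof.
move=> xy yD e e0; near=> s.
have st : s < t by near: s; exact: nbhs_left_lt.
have h : y t - y s <= (D + e) * (t - s) by near: s; exact: yD.
exact: le_trans (xy _ st) h.
Unshelve. all: by end_near. Qed.

End LeftDini.

Section AbsContMonotone.
Context {R : realType}.
Let mu : measure _ _ := @lebesgue_measure R.

(** Non-overlapping intervals may share an endpoint, hence the half-open ones: the head is then
    disjoint from all the others and can be removed from [U]. *)
Lemma sum_lengths_le (U : set R) (s : seq (R * R)) : measurable U ->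
  all (fun u => u.1 <= u.2) s ->
  pairwise (fun u w => (u.2 <= w.1) || (w.2 <= u.1)) s ->
  (forall u, u \in s -> `]u.1, u.2]%classic `<=` U) ->
  ((\sum_(u <- s) (u.2 - u.1))%:E <= mu U)%E.
Proof.
elim: s U => [|[a b] s IH] U mU; first by rewrite big_nil measure_ge0.
rewrite big_cons /= => /andP[ab sle] /andP[abs ps] sU.
have abU : `]a, b]%classic `<=` U := sU (a, b) (mem_head _ _).
have mab : measurable `]a, b]%classic by exact: measurable_itv.
have -> : mu U = ((b - a)%:E + mu (U `\` `]a, b]%classic))%E.
  rewrite -[in LHS](setDUK abU) measureU//; last 2 first.
  - exact: measurableD.
  - by rewrite setIDA setIC -setIDA setDv setI0.
  congr (_ + _)%E; rewrite [LHS](_ : _ = lebesgue_measure `]a, b]%classic)//.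
  rewrite lebesgue_measure_itv/= lte_fin.
  have [//|ba] := ltP a b.
  have -> : b = a by apply/eqP; rewrite eq_le ab ba.
  by rewrite subrr.
rewrite EFinD leeD2l//; apply: IH => //; first exact: measurableD.
move=> u us y uy; split; first by apply: (sU u); rewrite ?inE ?us ?orbT.
move: uy; rewrite /= !in_itv/= => /andP[? ?] /andP[? ?].
have /orP[] := allP abs _ us => /=; lra.
Qed.

Variables (x : R -> R) (a b : R).
Hypotheses (ab : a <= b) (xac : abs_continuous_on a b x).

(* [variation U t] is the variation of [x] over [U `&` [a, t]]. Subtracting it
   makes a function nonincreasing at the left of every point of [U], whatever
   the derivative of [x] does there. *)
Let in_list (U : set R) t (s : seq (R * R)) :=
  [/\ all (fun u => (a <= u.1) && (u.1 <= u.2) && (u.2 <= t)) s,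
      pairwise (fun u w => (u.2 <= w.1) || (w.2 <= u.1)) s &
      forall u, u \in s -> `]u.1, u.2]%classic `<=` U].

Let variations (U : set R) (t : R) : set R := [set \sum_(u <- s) `|x u.2 - x u.1| | s in in_list U t].

Let variation U t : R := sup (variations U t).

(** Let [N] be the exceptional null set and [d] the modulus of absolute continuity for [e]. An open
    [U] containing [N], of measure below [d], carries variation at most [e], so subtracting the
    variation over [U] and [e * t] perturbs [x] by little. The result [F] does not increase at the
    left of any point: in [U] because of the variation term, elsewhere because of the Dini bound. A
    supremum argument then gives [F b <= F a]. *)
Lemma abs_continuous_nonincreasing :
  {ae mu, forall t, a < t <= b -> left_dini_le x t 0} -> x b <= x a.
Proof.
move=> [N [mN N0 subN]].
suff xba (e : R) : 0 < e -> x b <= x a + e * (b - a + 2).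
  apply/ler_addgt0Pr => e e0; have b2 : 0 < b - a + 2 by move: ab; lra.
  by have := xba _ (divr_gt0 e0 b2); rewrite divfK// gt_eqF.
move=> e_gt0.
have [d d0 xd] := @xac _ e_gt0.
have [U [oU NU UNd]] : exists U, [/\ open U, N `<=` U & (mu (U `\` N) < d%:E)%E].
  by apply: lebesgue_regularity_outer => //; rewrite N0 ltry.
have mU : measurable U by exact: measurable_realfun.open_measurable.
have Ud : (mu U < d%:E)%E.
  rewrite -(setDUK NU) measureU//=; last 2 first.
  - exact: measurableD.
  - by rewrite setIDA setIC -setIDA setDv setI0.
  by rewrite N0 add0e.
have var_ub t : t <= b -> ubound (variations U t) e.
  move=> tb _ [s [s1 s2 s3] <-]; apply/ltW/xd => //.
  - apply/allP => u us; have /andP[/andP[-> ->]/=] := allP s1 _ us.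
    by move/le_trans; apply.
  - rewrite -lte_fin; apply: le_lt_trans Ud; apply: sum_lengths_le => //.
    by apply/allP => u us; have /andP[/andP[]] := allP s1 _ us.
have var0 t : variations U t 0.
  by exists [::]; rewrite ?big_nil//; split.
have var_sup t : t <= b -> has_sup (variations U t).
  by move=> tb; split; [exists 0; exact: var0|exists e; exact: var_ub].
have var_ge0 t : t <= b -> 0 <= variation U t.
  by move=> tb; apply: ub_le_sup => //; exists e; exact: var_ub.
have var_mono s t : s <= t -> t <= b -> variation U s <= variation U t.
  move=> st tb; apply: ge_sup; first by exists 0; exact: var0.
  move=> _ [l [l1 l2 l3] <-]; apply: ub_le_sup; first by exists e; exact: var_ub.
  exists l => //; split => //; apply/allP => u us.
  have /andP[/andP[-> ->]/=] := allP l1 _ us.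
  by move/le_trans; apply.
have var_add s t : a <= s -> s <= t -> t <= b -> `]s, t]%classic `<=` U ->
    variation U s + (x t - x s) <= variation U t.
  move=> as_ st tb stU; rewrite -lerBrDr; apply: ge_sup; first by exists 0; exact: var0.
  move=> _ [l [l1 l2 l3] <-]; rewrite lerBrDr.
  apply: (@le_trans _ _ (\sum_(u <- (s, t) :: l) `|x u.2 - x u.1|)).
    by rewrite big_cons/= addrC lerD2r ler_norm.
  apply: ub_le_sup; first by exists e; exact: var_ub.
  exists ((s, t) :: l) => //; split => /=.
  - rewrite as_ st lexx/=; apply/allP => u us.
    by have /andP[/andP[-> ->]/=] := allP l1 _ us; move/le_trans; apply.
  - rewrite l2 andbT; apply/allP => u us /=.
    by have /andP[_ ->] := allP l1 _ us; rewrite orbT.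
  - by move=> u; rewrite inE => /orP[/eqP ->//|]; exact: l3.
pose F t := x t - variation U t - e * t.
have Fleft c : a < c -> c <= b -> \forall s \near c^'-, F c <= F s.
  move=> ac cb; have [cU|cU] := pselect (U c).
    have [r /= r0 rU] := (open_nbhs_nbhs (conj oU cU)).
    near=> s.
    have sc : s < c by near: s; exact: nbhs_left_lt.
    have sa : a < s by near: s; exact: nbhs_left_gt.
    have sr : c - r < s by near: s; apply: nbhs_left_gt; rewrite ltrBlDr ltrDl.
    have := @var_add s c (ltW sa) (ltW sc) cb.
    have scU : `]s, c]%classic `<=` U.
      move=> y /=; rewrite in_itv/= => /andP[sy yc]; apply: rU => /=.
      by rewrite ger0_norm ?subr_ge0//; lra.
    by move=> /(_ scU); rewrite /F; nra.
  have xc : left_dini_le x c 0.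
    by apply: contrapT => h; apply/cU/NU/subN => /= hc; apply: h; apply: hc; rewrite ac.
  near=> s.
  have sc : s < c by near: s; exact: nbhs_left_lt.
  have sa : a < s by near: s; exact: nbhs_left_gt.
  have h : x c - x s <= (0 + e) * (c - s) by near: s; exact: xc.
  by have := var_mono _ _ (ltW sc) cb; rewrite /F; nra.
(* [variation] is nondecreasing, so to the right of [c] it can only lower [F]; an upward jump would
   have to come from [x], which is continuous. *)
have Fright c y : a <= c -> c < b -> F c < y -> exists2 r : R, 0 < r &
    forall t, c < t < c + r -> t <= b -> F t < y.
  move=> ac cb Fy.
  have [r r0 xr] := @xac (y - F c) ltac:(rewrite subr_gt0//).
  exists r => // t /andP[ct tr] tb.
  have := xr [:: (c, t)]; rewrite /= !big_seq1/= ac (ltW ct) tb/=.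
  move=> /(_ isT isT ltac:(lra)) /ltr_normlW.
  by have := var_mono _ _ (ltW ct) tb; rewrite /F; nra.
suff FF : F b <= F a.
  have := var_ub b (lexx _) _ => vb.
  have : variation U b <= e by apply: ge_sup; [exists 0; exact: var0|exact: var_ub].
  have := var_ge0 a ab.
  by move: FF; rewrite /F; nra.
rewrite leNgt; apply/negP => Fab.
(* Let [c] be the supremum of the times at which [F] is below the level [y]. If [F c < y], then
   [Fright] continues past [c]; otherwise [Fleft] keeps [F] at or above [y] just before [c]. Both
   contradict the choice of [c]. *)
pose y := (F a + F b) / 2.
have yFb : y < F b by rewrite /y; lra.
have Fay : F a < y by rewrite /y; lra.
pose S := [set t | a <= t <= b /\ F t < y].
have Sa : S a by split => //; rewrite lexx ab.
have supS : has_sup S by split; [exists a|exists b => t [/andP[]]].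
pose c := sup S.
have ac : a <= c by apply: ub_le_sup => //; case: supS.
have cb : c <= b by apply: ge_sup; [exists a|move=> t [/andP[]]].
have [Fc|Fc] := ltP (F c) y.
  have cb' : c < b by rewrite lt_neqAle cb andbT; apply/eqP => cE; move: Fc; rewrite cE; lra.
  have [r r0 Fr] := Fright c y ac cb' Fc.
  pose t := Num.min (c + r / 2) b.
  have ct : c < t by rewrite lt_min cb' andbT; lra.
  have tb : t <= b by rewrite ge_min lexx orbT.
  have tr : t < c + r by rewrite gt_min; apply/orP; left; lra.
  have : t <= c.
    apply: ub_le_sup; first by case: supS.
    by split; [lra|apply: Fr => //; lra].
  by lra.
have ac' : a < c by rewrite lt_neqAle ac andbT; apply/eqP => cE; move: Fc; rewrite -cE; lra.
have [r /= r0 Fr] := Fleft c ac' cb.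
have : c <= c - r.
  apply: ge_sup; first by exists a.
  move=> s Ss; rewrite leNgt; apply/negP => sr.
  have sc : s <= c by apply: ub_le_sup => //; case: supS.
  have sc' : s < c.
    by rewrite lt_neqAle sc andbT; apply/eqP => sE; case: Ss => _; rewrite sE; lra.
  have := Fr s; rewrite /= ger0_norm ?subr_ge0// => /(_ ltac:(lra) sc').
  by case: Ss; lra.
by lra.
Unshelve. all: by end_near. Qed.

End AbsContMonotone.

(** * Closure properties of absolute continuity *)

Section AbsContCalculus.
Context {R : realType}.
Implicit Types (a b C : R).

(** One criterion for sums, products and Lipschitz images. The sign of [C] is left free, whence the
    factor [|C| + 1] in the proof. *)
Lemma abs_continuous_dominated {V1 V2 W : normedModType R} (x1 : R -> V1)
    (x2 : R -> V2) (y : R -> W) a b C :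
  (forall s t, a <= s -> s <= t -> t <= b ->
    `|y t - y s| <= C * (`|x1 t - x1 s| + `|x2 t - x2 s|)) ->
  abs_continuous_on a b x1 -> abs_continuous_on a b x2 ->
  abs_continuous_on a b y.
Proof.
move=> yC ac1 ac2 e e0.
have C0 : 0 < 2 * (`|C| + 1) by rewrite mulr_gt0// ltr_wpDl.
have [d1 d10 h1] := ac1 _ (divr_gt0 e0 C0).
have [d2 d20 h2] := ac2 _ (divr_gt0 e0 C0).
exists (Num.min d1 d2); first by rewrite lt_min d10.
move=> s s1 s2; rewrite lt_min => /andP[s3 s4].
have {}h1 := h1 s s1 s2 s3; have {}h2 := h2 s s1 s2 s4.
apply: (@le_lt_trans _ _ ((`|C| + 1) * (\sum_(u <- s) `|x1 u.2 - x1 u.1| +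
    \sum_(u <- s) `|x2 u.2 - x2 u.1|))).
  rewrite -big_split/= mulr_sumr big_seq [leRHS]big_seq; apply: ler_sum => u us.
  have /andP[/andP[u1 u2] u3] := allP s1 _ us.
  apply: le_trans (yC _ _ u1 u2 u3) _; apply: ler_wpM2r; first exact: addr_ge0.
  by rewrite (le_trans (ler_norm C))// lerDl.
have -> : e = (`|C| + 1) * (e / (2 * (`|C| + 1)) + e / (2 * (`|C| + 1))).
  have : `|C| + 1 != 0 by rewrite gt_eqF// ltr_wpDl.
  by move=> C1; field.
by rewrite ltr_pM2l; [exact: ltrD|exact: ltr_wpDl].
Qed.

Lemma abs_continuous_lip {V W : normedModType R} (x : R -> V) (y : R -> W) a b C :
  (forall s t, a <= s -> s <= t -> t <= b -> `|y t - y s| <= C * `|x t - x s|) ->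
  abs_continuous_on a b x -> abs_continuous_on a b y.
Proof.
move=> yC xac; apply: (@abs_continuous_dominated _ _ _ x x _ _ _ `|C|) => // s t s1 st tb.
apply: le_trans (yC s t s1 st tb) _; have := ler_norm C.
by have : 0 <= `|x t - x s| by []; have : 0 <= `|C| by []; nra.
Qed.

Lemma abs_continuous_sub {V : normedModType R} (x : R -> V) a b c d :
  a <= c -> d <= b -> abs_continuous_on a b x -> abs_continuous_on c d x.
Proof.
move=> ac db xac e e0; have [r r0 h] := xac _ e0; exists r => // s s1 s2 s3.
apply: h => //; apply/allP => u us; have /andP[/andP[u1 ->] u3] := allP s1 _ us.
by rewrite (le_trans ac u1) (le_trans u3 db).
Qed.

Lemma abs_continuous_id a b : abs_continuous_on a b (@id R).
Proof.
move=> e e0; exists e => // s s1 s2; apply: le_lt_trans.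
rewrite big_seq [leRHS]big_seq; apply: ler_sum => u us.
by have /andP[/andP[_ u2] _] := allP s1 _ us; rewrite ger0_norm// subr_ge0.
Qed.

Lemma abs_continuous_cst {V : normedModType R} (k : V) a b :
  abs_continuous_on a b (fun=> k).
Proof.
apply: (@abs_continuous_lip _ _ id _ _ _ 0); last exact: abs_continuous_id.
by move=> s t _ _ _; rewrite subrr normr0 mul0r.
Qed.

Lemma abs_continuousD {V : normedModType R} (x y : R -> V) a b :
  abs_continuous_on a b x -> abs_continuous_on a b y ->
  abs_continuous_on a b (fun t => x t + y t).
Proof.
apply: (@abs_continuous_dominated _ _ _ _ _ _ _ _ 1) => s t _ _ _.
by rewrite mul1r opprD addrACA ler_normD.
Qed.

Lemma abs_continuous_sum {V : normedModType R} n (x : 'I_n -> R -> V) a b :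
  (forall i, abs_continuous_on a b (x i)) ->
  abs_continuous_on a b (fun t => \sum_i x i t).
Proof.
move=> xac; elim: (index_enum 'I_n) => [|i l IH].
  apply: (@abs_continuous_lip _ _ _ _ _ _ 1 _ (abs_continuous_cst (0 : V) a b)) => s t _ _ _.
  by rewrite !big_nil subrr normr0 mulr0.
apply: (@abs_continuous_lip _ _ _ _ _ _ 1 _ (abs_continuousD (xac i) IH)) => s t _ _ _.
by rewrite !big_cons mul1r.
Qed.

(** With [d] the modulus for the tolerance 1, the norm grows by less than 1 over a step of length
    [d / 2], and finitely many such steps cover the interval. *)
Lemma abs_continuous_bounded {V : normedModType R} (x : R -> V) a b :
  abs_continuous_on a b x -> exists2 M : R, 0 <= M &
    forall t, a <= t <= b -> `|x t| <= M.
Proof.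
move=> xac; have [d d0 h] := xac 1 ltr01.
have step k t : a <= t <= b -> t <= a + k%:R * (d / 2) -> `|x t| <= `|x a| + k%:R.
  elim: k t => [|k IH] t /andP[t1 t2].
    by rewrite mul0r !addr0 => t3; rewrite (_ : t = a)//; lra.
  move=> tk; have [ta|ta] := leP t (a + d / 2).
    have := h [:: (a, t)]; rewrite /= t1 t2 lexx !big_seq1/= => /(_ isT isT ltac:(lra)).
    have := ler_distD 0 (x t) (x a); rewrite subr0 sub0r normrN => _ xta.
    have := ler_normD (x t - x a) (x a); rewrite subrK -natr1.
    by have := ler0n R k; lra.
  have sb : a <= t - d / 2 <= b by lra.
  have sk : t - d / 2 <= a + k%:R * (d / 2) by move: tk; rewrite -natr1; lra.
  have := IH _ sb sk; have := h [:: (t - d / 2, t)].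
  rewrite /= t2 !big_seq1/= !andbT => /(_ ltac:(lra) isT ltac:(lra)) xts.
  have := ler_normD (x t - x (t - d / 2)) (x (t - d / 2)); rewrite subrK -natr1.
  by lra.
have [ab|ba] := leP a b; last by exists 0 => // t; lra.
pose k := (Num.truncn ((b - a) / (d / 2))).+1.
have bk : b - a < k%:R * (d / 2).
  by rewrite -ltr_pdivrMr ?divr_gt0// /k truncnS_gt.
exists (`|x a| + k%:R) => // t tab; apply: step => //; lra.
Qed.

Lemma abs_continuousM (x y : R -> R) a b :
  abs_continuous_on a b x -> abs_continuous_on a b y ->
  abs_continuous_on a b (fun t => x t * y t).
Proof.
move=> xac yac.
have [M M0 xM] := abs_continuous_bounded xac.
have [N N0 yN] := abs_continuous_bounded yac.
apply: (@abs_continuous_dominated _ _ _ x y _ _ _ (M + N)) => // s t as_ st tb.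
have -> : x t * y t - x s * y s = (x t - x s) * y t + x s * (y t - y s) by ring.
apply: le_trans (ler_normD _ _) _; rewrite !normrM.
have := xM s ltac:(lra); have := yN t ltac:(lra).
have : 0 <= `|x t - x s| by []; have : 0 <= `|y t - y s| by [].
have : 0 <= `|y t| by []; have : 0 <= `|x s| by [].
set A := `|_|; set B := `|_|; set D := `|_|; set E := `|_|; nra.
Qed.

Lemma abs_continuousZ (k : R) (x : R -> R) a b :
  abs_continuous_on a b x -> abs_continuous_on a b (fun t => k * x t).
Proof. by apply: abs_continuousM; exact: abs_continuous_cst. Qed.

Lemma abs_continuous_coord n (x : R -> 'cV[R]_n) i a b :
  abs_continuous_on a b x -> abs_continuous_on a b (fun t => x t i 0).
Proof.
apply: (@abs_continuous_lip _ _ _ _ _ _ 1) => s t _ _ _; rewrite mul1r.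
rewrite [leRHS]/Num.Def.normr/= mx_normrE; apply: le_trans (le_bigmax _ _ (i, 0)).
by rewrite !mxE.
Qed.

Lemma abs_continuous_expR (k : R) a b :
  abs_continuous_on a b (fun t => expR (k * t)).
Proof.
have h (u v : R) : u <= v -> `|expR v - expR u| <= expR v * (v - u).
  move=> uv; rewrite ger0_norm ?subr_ge0 ?ler_expR//.
  have := expR_ge1Dx (u - v); have := expRD v (u - v); rewrite addrC subrK => ->.
  have := expR_gt0 v; nra.
apply: (@abs_continuous_lip _ _ id _ _ _ (`|k| * expR (`|k| * (`|a| + `|b|))));
  last exact: abs_continuous_id.
move=> s t as_ st tb /=; rewrite (ger0_norm (_ : 0 <= t - s)) ?subr_ge0//.
set E := expR (_ * (_ + _)).
have bnd r : a <= r -> r <= b -> expR (k * r) <= E.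
  move=> ar rb; rewrite ler_expR; apply: le_trans (ler_norm _) _.
  rewrite normrM ler_wpM2l// ler_norml.
  have := ler_norm b; have := ler_norm (- a); rewrite normrN.
  by have : 0 <= `|a| by []; have : 0 <= `|b| by []; lra.
have Es := bnd s as_ (le_trans st tb); have Et := bnd t (le_trans as_ st) tb.
have ts0 : 0 <= t - s by rewrite subr_ge0.
have [k0|k0] := leP 0 k.
  rewrite (ger0_norm k0); have kst : k * s <= k * t by rewrite ler_wpM2l.
  apply: le_trans (h _ _ kst) _.
  have -> : k * E * (t - s) = E * (k * t - k * s) by ring.
  by apply: ler_wpM2r => //; rewrite subr_ge0.
have kst : k * t <= k * s by rewrite ler_wnM2l// ltW.
rewrite distrC; apply: le_trans (h _ _ kst) _; rewrite (ltr0_norm k0).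
have -> : - k * E * (t - s) = E * (k * s - k * t) by ring.
by apply: ler_wpM2r => //; rewrite subr_ge0.
Qed.

End AbsContCalculus.

(** * Differential inequalities holding almost everywhere: Gronwall and Barbalat *)

Section DifferentialInequalities.
Context {R : realType}.

Implicit Types (x : R -> R) (a b c s t u k D M T : R).

Lemma lebesgue_aeS (A B : set R) : A `<=` B ->
  {ae (@lebesgue_measure R), forall t, A t} ->
  {ae (@lebesgue_measure R), forall t, B t}.
Proof. by move=> AB; apply: negligibleS; exact: subsetC. Qed.

Lemma abs_continuous_increment_le x a b D : a <= b -> abs_continuous_on a b x ->
  {ae (@lebesgue_measure R), forall t, a < t <= b -> left_dini_le x t D} ->
  x b - x a <= D * (b - a).
Proof.
move=> ab xac xD.
suff : x b + - D * b <= x a + - D * a by lra.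
apply: (@abs_continuous_nonincreasing _ (fun t => x t + - D * t) a b) => //.
  by apply: abs_continuousD => //; apply: abs_continuousZ; exact: abs_continuous_id.
apply: lebesgue_aeS xD => t xD tab; rewrite -[0](subrr D).
apply: (@left_dini_leD _ x); first exact: xD.
apply: is_derive_left_dini; rewrite -[- D in X in is_derive _ _ _ X]mulr1.
exact: (@is_deriveZ _ _ _ id).
Qed.

Lemma abs_continuous_lipschitz x a b M : a <= b -> abs_continuous_on a b x ->
  {ae (@lebesgue_measure R), forall t, a < t <= b ->
    exists2 D : R, is_derive t 1 x D & `|D| <= M} ->
  `|x b - x a| <= M * (b - a).
Proof.
move=> ab xac xM; rewrite ler_norml lerNl; apply/andP; split; last first.
  apply: abs_continuous_increment_le => //.
  apply: lebesgue_aeS xM => t + tab => /(_ tab)[D xD /ler_normlP[_ DM]].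
  by apply: left_dini_leW DM _; exact: is_derive_left_dini.
have -> : - (x b - x a) = - x b - - x a by ring.
apply: (@abs_continuous_increment_le (fun t => - x t)) => //.
  apply: (@abs_continuous_lip _ _ _ _ _ _ _ 1 _ xac) => s t _ _ _.
  by rewrite -opprD normrN mul1r.
apply: lebesgue_aeS xM => t + tab => /(_ tab)[D xD /ler_normlP[DM _]].
apply: left_dini_leW DM _; apply: is_derive_left_dini; exact: is_deriveN.
Qed.

Lemma is_derive_expR_scale k s :
  is_derive s 1 (fun t : R => expR (k * t)) (k * expR (k * s)).
Proof.
have kd : is_derive s 1 (fun t : R => k *: t) (k *: 1).
  exact: (@is_deriveZ _ _ _ id).
rewrite [k * expR _]mulrC -[X in _ * X]mulr1.
exact: (@is_derive1_comp _ expR (fun t => k * t)).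
Qed.

Lemma exp_decay x k : (forall T, 0 <= T -> abs_continuous_on 0 T x) ->
  {ae (@lebesgue_measure R), forall t, 0 < t ->
    exists2 D : R, is_derive t 1 x D & D <= - k * x t} ->
  forall t, 0 <= t -> x t <= x 0 * expR (- k * t).
Proof.
move=> xac xD t t0.
suff : expR (k * t) * x t <= expR (k * 0) * x 0.
  rewrite mulr0 expR0 mul1r mulNr expRN -ler_pdivlMl ?expR_gt0//.
  by rewrite mulrC.
apply: (@abs_continuous_nonincreasing _ (fun t => expR (k * t) * x t)) => //.
  by apply: abs_continuousM; [exact: abs_continuous_expR|exact: xac].
apply: lebesgue_aeS xD => s + st => /(_ ltac:(lra))[D xD Dk].
have := @is_deriveM _ _ _ _ _ _ _ _ (is_derive_expR_scale k s) xD.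
move/is_derive_left_dini; apply: left_dini_leW.
rewrite /GRing.scale/=; have := expR_gt0 (k * s); nra.
Qed.

(** [V] is nonincreasing, so from some [T] on it exceeds its infimum by less than
    [c * (e / 2) ^+ 2 * tau]. If [|q t| >= e] later on, the Lipschitz bound keeps [|q|] above
    [e / 2] for a time [tau = e / (2 * M)], and [V] would fall below its infimum. *)
Lemma barbalat (V q : R -> R) c M : 0 < c -> 0 < M ->
  (forall T, 0 <= T -> abs_continuous_on 0 T V) ->
  (forall t, 0 <= t -> 0 <= V t) ->
  (forall s t, 0 <= s -> s <= t -> `|q t - q s| <= M * (t - s)) ->
  {ae (@lebesgue_measure R), forall t, 0 < t -> left_dini_le V t (- c * q t ^+ 2)} ->
  q t @[t --> +oo] --> (0 : R).
Proof.
move=> c0 M0 Vac V0 qM VD; apply/cvgrPdist_lt => /= e e0.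
have dec (s t D : R) : 0 <= s -> s <= t -> (forall u : R, s <= u <= t -> D <= q u ^+ 2) ->
    V t - V s <= - c * D * (t - s).
  move=> s0 st qD; apply: abs_continuous_increment_le => //.
    by apply: abs_continuous_sub (Vac t _) => //; lra.
  apply: lebesgue_aeS VD => u + st' => /(_ ltac:(lra)); apply: left_dini_leW.
  by have := qD u ltac:(lra); nra.
pose S : set R := [set V t | t in [set t : R | 0 <= t]].
have S0 : S !=set0 by exists (V 0), 0 => /=.
have infS : has_inf S by split => //; exists 0 => _ [t t0 <-]; exact: V0.
pose tau := e / (2 * M).
have tau0 : 0 < tau by rewrite divr_gt0// mulr_gt0.
have tauM : M * tau = e / 2 by rewrite /tau; field; rewrite gt_eqF.
have del0 : 0 < c * (e / 2) ^+ 2 * tau.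
  by apply: mulr_gt0 => //; apply: mulr_gt0 => //; apply: exprn_gt0; lra.
have [_ [T T0 <-] VT] := inf_adherent del0 infS.
near=> t; rewrite sub0r normrN ltNge; apply/negP => qt.
have Tt : T <= t by near: t; apply: nbhs_pinfty_ge; exact: num_real.
move: T0; rewrite /= => T0.
have VtT : V t <= V T.
  have := dec T t 0 T0 Tt (fun u _ => sqr_ge0 _).
  by rewrite mulr0 mul0r subr_le0.
have := dec t (t + tau) ((e / 2) ^+ 2) ltac:(lra) ltac:(lra) _.
have qtau u : t <= u <= t + tau -> (e / 2) ^+ 2 <= q u ^+ 2.
  move=> /andP[tu ut]; rewrite -[leRHS]real_normK ?num_real//.
  rewrite ler_sqr ?nnegrE//; last by lra.
  have := qM t u ltac:(lra) tu; have := ler_distD 0 (q t) (q u).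
  have := ler_normD (q t - q u) (q u); rewrite subrK (distrC (q t)).
  by nra.
move=> /(_ qtau).
have : inf S <= V (t + tau) by apply: inf_lbound; [case: infS|exists (t + tau) => //=; lra].
by nra.
Unshelve. all: by end_near. Qed.

End DifferentialInequalities.

(** * Convex functions and the generalized gradient *)

Section ConvexReal.
Context {R : realType}.
Implicit Types (phi psi : R -> R).

Definition convex_real phi := forall x y t, 0 <= t -> t <= 1 ->
  phi (t * x + (1 - t) * y) <= t * phi x + (1 - t) * phi y.

Lemma convex_function_real phi :
  @convex_function R R^o setT phi -> convex_real phi.
Proof.
move=> cphi x y t t0 t1.
by have := cphi (Itv01 t0 t1) x y; rewrite !inE => /(_ I I).
Qed.

Lemma convex_realD phi psi : convex_real phi -> convex_real psi ->
  convex_real (fun x => phi x + psi x).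
Proof. by move=> h1 h2 x y t t0 t1; have := h1 x y t t0 t1; have := h2 x y t t0 t1; lra. Qed.

Lemma convex_realZ phi k : 0 <= k -> convex_real phi -> convex_real (fun x => k * phi x).
Proof. by move=> k0 h x y t t0 t1; have := h x y t t0 t1; nra. Qed.

Lemma convex_pos_part (a b : R) : convex_real (fun x => Num.max 0 (a * x + b)).
Proof.
move=> x y t t0 t1; rewrite ge_max; apply/andP; split.
  by apply: addr_ge0; apply: mulr_ge0; rewrite ?subr_ge0// le_max lexx.
have : a * x + b <= Num.max 0 (a * x + b) by rewrite le_max lexx orbT.
have : a * y + b <= Num.max 0 (a * y + b) by rewrite le_max lexx orbT.
set A := Num.max _ _; set B := Num.max _ _; nra.
Qed.

Lemma convex_real_increase phi x y u : (forall x, 0 <= phi x) -> convex_real phi ->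
  (x <= y /\ y + 1 <= u) \/ (y <= x /\ u <= y - 1) ->
  phi y - phi x <= phi u * `|y - x|.
Proof.
move=> phi0 cphi xyu; have [<-|xy] := eqVneq x y.
  by rewrite !subrr normr0 mulr0.
pose t := (y - x) / (u - x).
have ux : u - x != 0 by rewrite subr_eq0; case: xyu => -[? ?]; lra.
have tux : t * (u - x) = y - x by rewrite divfK.
have [t0 [t1 txy]] : 0 <= t /\ t <= 1 /\ t <= `|y - x|.
  case: xyu => -[xy1 yu].
  - have ux0 : 0 < u - x by lra.
    split; first by apply: divr_ge0; lra.
    split; first by rewrite ler_pdivrMr//; lra.
    rewrite ger0_norm ?subr_ge0// ler_pdivrMr//.
    by nra.
  - have ux0 : 0 < x - u by lra.
    rewrite /t -mulrNN -invrN !opprB.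
    split; first by apply: divr_ge0; lra.
    split; first by rewrite ler_pdivrMr//; lra.
    rewrite ler0_norm ?subr_le0// opprB ler_pdivrMr//; nra.
have := cphi u x t t0 t1.
have -> : t * u + (1 - t) * x = y by rewrite -[RHS](subrK x) -tux; ring.
have := phi0 u; have := phi0 x; nra.
Qed.

Lemma convex_real_lip phi (K x y : R) : (forall x, 0 <= phi x) -> convex_real phi ->
  `|x| <= K -> `|y| <= K ->
  `|phi y - phi x| <= (phi (K + 1) + phi (- K - 1)) * `|y - x|.
Proof.
move=> phi0 cphi; rewrite 2!ler_norml => /andP[x1 x2] /andP[y1 y2].
have a1 := phi0 (K + 1); have a2 := phi0 (- K - 1).
have n0 : 0 <= `|y - x| by [].
wlog xy : x y x1 x2 y1 y2 n0 / x <= y => [wl|].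
  have [xy|/ltW yx] := leP x y; first exact: wl.
  by rewrite (distrC (phi y)) (distrC y); rewrite distrC in n0; exact: wl.
rewrite ler_norml; apply/andP; split.
  have := @convex_real_increase phi y x (- K - 1) phi0 cphi.
  by rewrite (distrC x) => /(_ ltac:(right; split; lra)); nra.
have := @convex_real_increase phi x y (K + 1) phi0 cphi.
by move=> /(_ ltac:(left; split; lra)); nra.
Qed.

Lemma convex_real_continuous phi : (forall x, 0 <= phi x) -> convex_real phi ->
  continuous phi.
Proof.
move=> phi0 cphi x; apply/cvgrPdist_le => e e0.
pose C := phi (`|x| + 1 + 1) + phi (- (`|x| + 1) - 1).
have C0 : 0 <= C by rewrite addr_ge0.
have C1 : 0 < C + 1 by lra.
near=> y.
have yx1 : `|x - y| <= 1 by near: y; apply: cvgr_dist_le => //; exact: cvg_id.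
have yxe : `|x - y| <= e / (C + 1).
  by near: y; apply: cvgr_dist_le; [exact: cvg_id|exact: divr_gt0].
have y1 : `|y| <= `|x| + 1.
  have := ler_normD x (y - x); rewrite addrC subrK (distrC y); lra.
rewrite distrC.
apply: le_trans (convex_real_lip phi0 cphi _ y1) _; first by rewrite lerDl.
rewrite -/C distrC; apply: (@le_trans _ _ (C * (e / (C + 1)))); first by rewrite ler_wpM2l.
by rewrite mulrCA ger_pMr// ler_pdivrMr// mul1r; lra.
Unshelve. all: by end_near. Qed.

End ConvexReal.

(** * The generalized gradient of a separable convex function *)

Section SeparableConvex.
Context {R : realType} {n : nat}.
Variable phi : 'I_n -> R -> R.
Hypotheses (phi_ge0 : forall i x, 0 <= phi i x) (phi_convex : forall i, convex_real (phi i)).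
Implicit Types (P Q d zeta : 'cV[R]_n).

Definition separable P : R := \sum_i phi i (P i 0).

Lemma separable_continuous : continuous separable.
Proof.
have phiC i : continuous (fun Q : 'cV[R]_n => phi i (Q i 0)).
  move=> P; apply: (@continuous_comp _ _ _ (fun Q : 'cV[R]_n => Q i 0) (phi i)).
    exact: coord_continuous.
  exact: convex_real_continuous.
rewrite (_ : separable = \sum_i (fun Q : 'cV[R]_n => phi i (Q i 0))).
  elim/big_ind : _ => [|g h gC hC|i _] P; last exact: phiC.
    exact: (@cst_continuous _ _ (0 : R)).
  by apply: continuousD; [exact: gC|exact: hC].
by apply/funext => P; rewrite fct_sumE.
Qed.

Lemma separable_ge0 P : 0 <= separable P.
Proof. by apply: sumr_ge0 => i _; exact: phi_ge0. Qed.

(** For 0 < h < 1, convexity bounds the difference quotient at y in the direction Q - P by the full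
    increment from y to y + (Q - P). By continuity this increment is close to
    [separable Q - separable P] for y near P, so the limsup does not exceed the latter. *)
Lemma clarke_gradient_subgradient P Q zeta : clarke_gradient separable P zeta ->
  dotp zeta (Q - P) <= separable Q - separable P.
Proof.
move=> /(_ (Q - P)) h; apply/ler_addgt0Pr => e e0.
rewrite -lee_fin; apply: le_trans h _.
rewrite /clarke_dderiv limf_esupE.
pose V := [set yh : 'cV[R]_n * R | 0 < yh.2 < 1 /\
  separable (yh.1 + (Q - P)) - separable yh.1 <= separable Q - separable P + e].
have FV : filter_prod (nbhs P) (0 : R)^'+ V.
  exists ([set y : 'cV[R]_n | separable (y + (Q - P)) - separable y <= separable Q - separable P + e],
          [set h : R | 0 < h < 1]); last by move=> [y h] [].
  split => /=; last first.
    near=> k; apply/andP; split; [near: k; exact: nbhs_right_gt|].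
    by near: k; exact: nbhs_right_lt.
  have sQ : {for P, continuous (fun y : 'cV[R]_n => separable (y + (Q - P)) - separable y)}.
    apply: continuousB; last exact: separable_continuous.
    apply: continuous_comp; last exact: separable_continuous.
    by apply: continuousD => //; exact: cst_continuous.
  by move/cvgr_le : sQ; apply; rewrite [P + _]addrC subrK ltrDl.
apply: (@le_trans _ _ (ereal_sup
    [set ((separable (yh.1 + yh.2 *: (Q - P)) - separable yh.1) / yh.2)%:E | yh in V])).
  by apply: ereal_inf_lbound; exists V.
apply: ge_ereal_sup => _ [[y h] /= [/andP[h0 h1] Ve] <-].
rewrite lee_fin; apply: le_trans Ve; rewrite ler_pdivrMr//.
rewrite /separable -!sumrB mulr_suml; apply: ler_sum => i _.
rewrite !mxE.
have := @phi_convex i (y i 0 + (Q i 0 - P i 0)) (y i 0) h (ltW h0) (ltW h1).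
have -> : h * (y i 0 + (Q i 0 - P i 0)) + (1 - h) * y i 0 =
  y i 0 + h * (Q i 0 - P i 0) by ring.
by lra.
Unshelve. all: by end_near. Qed.

Lemma clarke_gradient_coord P zeta i (tau : R) : clarke_gradient separable P zeta ->
  zeta i 0 * tau <= phi i (P i 0 + tau) - phi i (P i 0).
Proof.
move=> /(@clarke_gradient_subgradient _ (P + tau *: delta_mx i 0)).
rewrite addrAC subrr add0r /dotp (bigD1 i)//= big1 => [|j ji]; last first.
  by rewrite !mxE (negbTE ji)/= mulr0 mulr0.
rewrite !mxE !eqxx mulr1 addr0 => /le_trans; apply.
rewrite /separable -sumrB (bigD1 i)//= big1 => [|j ji]; last first.
  by rewrite !mxE (negbTE ji)/= mulr0 addr0 subrr.
by rewrite addr0 !mxE !eqxx mulr1.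
Qed.

(** The step from [P i 0] to [K + 1] has length at least 1, so a positive [zeta i 0] is at most its
    product with that step. The bound is one-sided on purpose: [clarke_mean_le] knows a coordinate
    from one side only. *)
Lemma clarke_gradient_le P zeta i (K : R) : clarke_gradient separable P zeta ->
  P i 0 <= K -> zeta i 0 <= phi i (K + 1).
Proof.
move=> /(clarke_gradient_coord i (K + 1 - P i 0)); rewrite (addrC (P i 0)) subrK => h PK.
have := phi_ge0 i (P i 0); have := phi_ge0 i (K + 1).
by have [|] := leP 0 (zeta i 0); nra.
Qed.

Lemma clarke_gradient_ge P zeta i (K : R) : clarke_gradient separable P zeta ->
  - K <= P i 0 -> - phi i (- K - 1) <= zeta i 0.
Proof.
move=> /(clarke_gradient_coord i (- K - 1 - P i 0)); rewrite (addrC (P i 0)) subrK => h PK.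
have := phi_ge0 i (P i 0); have := phi_ge0 i (- K - 1).
by have [|] := leP 0 (zeta i 0); nra.
Qed.

Lemma separable_lip K P Q : (forall i, `|P i 0| <= K) -> (forall i, `|Q i 0| <= K) ->
  `|separable P - separable Q| <=
     \sum_i (phi i (K + 1) + phi i (- K - 1)) * `|P i 0 - Q i 0|.
Proof.
move=> PK QK; rewrite /separable -sumrB; apply: le_trans (ler_norm_sum _ _ _) _.
by apply: ler_sum => i _; exact: convex_real_lip.
Qed.

End SeparableConvex.

(** * Eigenvalue bounds for the Laplacian *)

Lemma lipschitz_continuous {R : realType} {V W : normedModType R} (f : V -> W) (C : R) :
  (forall x y, `|f x - f y| <= C * `|x - y|) -> continuous f.
Proof.
move=> fC x; apply/cvgrPdist_le => e e0.
have C1 : 0 < `|C| + 1 by rewrite ltr_wpDl.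
near=> y.
have xy : `|x - y| <= e / (`|C| + 1).
  by near: y; apply: cvgr_dist_le; [exact: cvg_id|exact: divr_gt0].
apply: le_trans (fC _ _) _; rewrite ler_pdivlMr// in xy.
have := ler_norm C; have : 0 <= `|x - y| by []; nra.
Unshelve. all: by end_near. Qed.

(** * Inner product, compactness and Rayleigh quotients *)

Section DotProduct.
Context {R : realType} {n : nat}.
Implicit Types (x y u : 'cV[R]_n) (M S : 'M[R]_n).

Lemma dotpE x y : dotp x y = (x^T *m y) 0 0.
Proof. by rewrite mxE; apply: eq_bigr => i _; rewrite mxE. Qed.

Lemma dotpC x y : dotp x y = dotp y x.
Proof. by apply: eq_bigr => i _; rewrite mulrC. Qed.

Lemma dotpDr x y u : dotp x (y + u) = dotp x y + dotp x u.
Proof. by rewrite !dotpE mulmxDr mxE. Qed.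

Lemma dotpZr (k : R) x y : dotp x (k *: y) = k * dotp x y.
Proof. by rewrite !dotpE -scalemxAr mxE. Qed.

Lemma dotpNr x y : dotp x (- y) = - dotp x y.
Proof. by rewrite !dotpE mulmxN mxE. Qed.

Lemma dotpDl x y u : dotp (y + u) x = dotp y x + dotp u x.
Proof. by rewrite dotpC dotpDr !(dotpC x). Qed.

Lemma dotpZl (k : R) x y : dotp (k *: x) y = k * dotp x y.
Proof. by rewrite dotpC dotpZr dotpC. Qed.

Lemma dotp_mulmx M x y : dotp x (M *m y) = dotp (M^T *m x) y.
Proof. by rewrite !dotpE trmx_mul trmxK mulmxA. Qed.

Lemma dotp_ge0 x : 0 <= dotp x x.
Proof. by apply: sumr_ge0 => i _; rewrite -expr2 sqr_ge0. Qed.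

Lemma sqr_coord_le_dotp x i : x i 0 ^+ 2 <= dotp x x.
Proof.
rewrite /dotp (bigD1 i)//= -expr2 lerDl; apply: sumr_ge0 => j _.
by rewrite -expr2 sqr_ge0.
Qed.

Lemma dotp_eq0 x : (dotp x x == 0) = (x == 0).
Proof.
apply/eqP/eqP => [x0|->]; last by rewrite dotpE mulmx0 mxE.
apply/matrixP => i j; rewrite ord1 mxE; apply/eqP; rewrite -sqrf_eq0.
by rewrite eq_le sqr_ge0 andbT -x0 sqr_coord_le_dotp.
Qed.

Lemma dotp_gt0 x : x != 0 -> 0 < dotp x x.
Proof. by move=> x0; rewrite lt_def dotp_eq0 x0 dotp_ge0. Qed.

Lemma coord_le_norm x i : `|x i 0| <= `|x|.
Proof.
by rewrite [leRHS]/Num.Def.normr/= mx_normrE; apply: (le_bigmax _ _ (i, 0)).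
Qed.

Lemma norm_le_coord x (e : R) : 0 <= e -> (forall i, `|x i 0| <= e) -> `|x| <= e.
Proof.
move=> e0 xe; rewrite [leLHS]/Num.Def.normr/= mx_normrE; apply: bigmax_le => //.
by move=> [i j] _ /=; rewrite ord1.
Qed.

Lemma dotp_continuous (f g : 'cV[R]_n -> 'cV[R]_n) : continuous f -> continuous g ->
  continuous (fun x => dotp (f x) (g x)).
Proof.
move=> fC gC.
have hC (h : 'cV[R]_n -> 'cV[R]_n) i : continuous h -> continuous (fun x => h x i 0).
  move=> hC x; apply: (@continuous_comp _ _ _ h (fun y : 'cV[R]_n => y i 0)); first exact: hC.
  exact: coord_continuous.
rewrite (_ : (fun _ => _) = \sum_i (fun x => f x i 0 * g x i 0)).
  elim/big_ind : _ => [|p q pC qC|i _] x.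
  - exact: (@cst_continuous _ _ (0 : R)).
  - by apply: continuousD; [exact: pC|exact: qC].
  - by apply: continuousM; apply: hC.
by apply/funext => x; rewrite fct_sumE.
Qed.

Lemma mulmx_col_continuous M : continuous (fun x => M *m x).
Proof.
apply: (@lipschitz_continuous _ 'cV[R]_n 'cV[R]_n _ (\sum_i \sum_j `|M i j|)) => x y.
have C0 i : 0 <= \sum_j `|M i j| by exact: sumr_ge0.
rewrite -mulmxBr; apply: norm_le_coord; first by rewrite mulr_ge0// sumr_ge0.
move=> i; rewrite mxE; apply: le_trans (ler_norm_sum _ _ _) _.
apply: (@le_trans _ _ (\sum_j `|M i j| * `|x - y|)).
  by apply: ler_sum => j _; rewrite normrM ler_wpM2l// coord_le_norm.
by rewrite -mulr_suml ler_wpM2r// [leRHS](bigD1 i)//= lerDl sumr_ge0.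
Qed.

(** Carried over from row vectors by transposition, which preserves the maximum norm. *)
Lemma col_bounded_closed_compact (A : set 'cV[R]_n) :
  bounded_set A -> closed A -> compact A.
Proof.
have tC m k : continuous (@trmx R m k).
  apply: (@lipschitz_continuous _ 'M[R]_(m, k) 'M[R]_(k, m) _ 1) => x y.
  rewrite mul1r -linearB/= [leLHS]/Num.Def.normr/= mx_normrE.
  apply: bigmax_le => // -[i j] _.
  rewrite mxE [leRHS]/Num.Def.normr/= mx_normrE.
  exact: (le_bigmax _ _ (j, i)).
move=> [M [Mreal bA]] cA.
have -> : A = trmx @` [set y : 'rV[R]_n | A y^T].
  apply/seteqP; split => [x Ax|_ [y Ay <-]//].
  by exists x^T => /=; rewrite trmxK.
apply: continuous_compact.
  by apply: continuous_subspaceT; exact: tC.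
apply: bounded_closed_compact; last first.
  by apply: closed_comp => // y _; exact: tC.
exists M; split => // N MN y /= /(bA N MN) yN; apply: le_trans yN.
rewrite [leLHS]/Num.Def.normr/= mx_normrE; apply: bigmax_le => // -[i j] _ /=.
by have := coord_le_norm y^T j; rewrite mxE ord1.
Qed.

(** The quadratic form attains its minimum on the unit sphere of the orthogonal complement of [u].
    This complement is stable under [S], so the first-order condition makes the minimizer an
    eigenvector. The vector of ones as [u] serves [lambda2]; [u = 0] imposes no constraint and
    serves [lambda_max]. *)
Lemma rayleigh_min S u x0 : S^T = S -> S *m u = 0 -> x0 != 0 -> dotp u x0 = 0 ->
  exists x1 (m : R), [/\ x1 != 0, dotp u x1 = 0, S *m x1 = m *: x1 &
    forall x, dotp u x = 0 -> m * dotp x x <= dotp x (S *m x)].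
Proof.
move=> Ssym Su x00 ux0.
pose K := [set x | dotp u x = 0 /\ dotp x x = 1].
have sphere x : x != 0 -> dotp u x = 0 -> K ((Num.sqrt (dotp x x))^-1 *: x).
  move=> x_neq0 ux; split; first by rewrite dotpZr ux mulr0.
  rewrite dotpZr dotpZl mulrA -expr2 exprVn sqr_sqrtr ?dotp_ge0//.
  by rewrite mulVf// dotp_eq0.
have idC : continuous (@idfun 'cV[R]_n) by move=> ?; exact: cvg_id.
have cstC (y : 'cV[R]_n) : continuous (fun _ : 'cV[R]_n => y) by exact: cst_continuous.
have cK : compact K.
  apply: col_bounded_closed_compact.
    exists 1; split => // N N1 x [_ x1]; apply: norm_le_coord => [|i]; first lra.
    have := sqr_coord_le_dotp x i; rewrite x1 -ler_sqrt ?sqrtr_sqr ?sqrtr1//; lra.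
  rewrite (_ : K = (dotp u @^-1` [set 0]) `&` ((fun x => dotp x x) @^-1` [set 1]))//.
  by apply: closedI; apply: closed_comp => [x _|]; by
    [apply: dotp_continuous|exact: closed_eq].
have [x1 /set_mem[ux1 x11] x1min] :
    exists2 x1, x1 \in K & forall x, x \in K -> dotp x1 (S *m x1) <= dotp x (S *m x).
  apply: (@compact_EVT_min _ _ (fun x => dotp x (S *m x))) => //.
    by exists ((Num.sqrt (dotp x0 x0))^-1 *: x0); exact: sphere.
  apply: continuous_subspaceT; apply: dotp_continuous => //.
  exact: mulmx_col_continuous.
pose m := dotp x1 (S *m x1).
have Smin x : dotp u x = 0 -> m * dotp x x <= dotp x (S *m x).
  have [->|x_neq0] := eqVneq x 0.
    by rewrite dotpC !mulmx0 !dotpE !mulmx0 !mxE mulr0.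
  move=> ux; have := x1min _ (mem_set (sphere x x_neq0 ux)).
  rewrite -scalemxAr dotpZr dotpZl mulrA -expr2 exprVn sqr_sqrtr ?dotp_ge0//.
  by rewrite ler_pdivlMl ?dotp_gt0// mulrC.
exists x1, m; split => //.
  by apply/eqP => x1E; move: x11; rewrite x1E dotpE mulmx0 mxE; lra.
have [y yE] : exists y, y = S *m x1 - m *: x1 by eexists.
have uy : dotp u y = 0.
  rewrite yE dotpDr dotpNr dotpZr ux1 mulr0 subr0 dotp_mulmx Ssym Su.
  by rewrite dotpC dotpE mulmx0 mxE.
apply/eqP; rewrite -subr_eq0 -yE -dotp_eq0; apply/eqP.
(* Minimality along [x1 - tau y] gives [2 tau |y|^2 <= tau^2 (q y - m |y|^2)]. *)
pose q := dotp y (S *m y) - m * dotp y y.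
have yS : dotp y (S *m x1) = dotp y y + m * dotp y x1.
  by rewrite [X in dotp y X + _]yE dotpDr dotpNr dotpZr subrK.
have Sy : dotp x1 (S *m y) = dotp y (S *m x1) by rewrite dotp_mulmx Ssym dotpC.
have quad (tau : R) : 2 * tau * dotp y y <= tau ^+ 2 * q.
  have := Smin (x1 + (- tau) *: y); rewrite dotpDr dotpZr ux1 uy mulr0 addr0.
  move=> /(_ erefl); rewrite mulmxDr -scalemxAr.
  rewrite !(dotpDl, dotpDr, dotpZl, dotpZr) (dotpC x1 y) Sy yS x11 -/m /q.
  by nra.
have yge0 := dotp_ge0 y.
have q0 : 0 <= q by have := quad 1; rewrite expr1n !mul1r mulr1; lra.
have q1 : 0 < q + 1 by lra.
(* At this [tau] the inequality [quad] reads [2 * tau ^+ 2 * (q + 1) <= tau ^+ 2 * q], which forces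
   [tau = 0]; the 1 keeps the denominator positive. *)
pose tau := dotp y y / (q + 1).
have tauE : dotp y y = tau * (q + 1) by rewrite divfK// gt_eqF.
have : tau ^+ 2 <= 0 by have := quad tau; have := sqr_ge0 tau; rewrite tauE; nra.
move=> tau0; have : tau ^+ 2 == 0 by rewrite eq_le tau0 sqr_ge0.
by rewrite sqrf_eq0 => /eqP tauE0; rewrite tauE tauE0 mul0r.
Qed.

End DotProduct.

Section Laplacian.
Context {R : realType} {n : nat}.
Variable A : 'M[R]_n.
Let L := laplacian A.
Let one : 'cV[R]_n := const_mx 1.
Implicit Types x : 'cV[R]_n.

Lemma dotp1 x : dotp one x = \sum_i x i 0.
Proof. by apply: eq_bigr => i _; rewrite mxE mul1r. Qed.

Lemma laplacianE x i : (L *m x) i 0 = \sum_j A i j * (x i 0 - x j 0).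
Proof.
rewrite mulmxBl mxE mul_diag_mx !mxE mulr_suml -sumrB.
by apply: eq_bigr => j _; rewrite mulrBr.
Qed.

Lemma laplacian1 : L *m one = 0.
Proof.
apply/matrixP => i j; rewrite ord1 laplacianE big1 => [|k _]; first by rewrite mxE.
by rewrite !mxE subrr mulr0.
Qed.

Hypothesis A_balanced : weight_balanced A.

Lemma tr_laplacian1 : L^T *m one = 0.
Proof.
apply/matrixP => i j; rewrite ord1 !mxE.
rewrite (eq_bigr (fun k => (\sum_l A k l) *+ (k == i) - A k i)); last first.
  by move=> k _; rewrite !mxE mulr1.
rewrite sumrB (eq_bigr (fun k => if k == i then \sum_l A k l else 0)); last first.
  by move=> k _; rewrite mulrb.
by rewrite -big_mkcond big_pred1_eq A_balanced subrr.
Qed.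

Lemma sum_laplacian x : \sum_i (L *m x) i 0 = 0.
Proof. by rewrite -dotp1 dotp_mulmx tr_laplacian1 dotpE trmx0 mul0mx mxE. Qed.

(** Weight balance makes the sum of a_ij (x_i^2 - x_j^2) vanish, and adding this sum turns (x_i -
    x_j)^2 into 2 x_i (x_i - x_j). *)
Lemma laplacian_form x :
  2 * dotp x (L *m x) = \sum_i \sum_j A i j * (x i 0 - x j 0) ^+ 2.
Proof.
have E : \sum_i \sum_j A i j * (x i 0 ^+ 2 - x j 0 ^+ 2) = 0.
  transitivity (\sum_i \sum_j A i j * x i 0 ^+ 2 - \sum_i \sum_j A i j * x j 0 ^+ 2).
    rewrite -sumrB; apply: eq_bigr => i _; rewrite -sumrB; apply: eq_bigr => j _.
    by rewrite mulrBr.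
  rewrite [X in _ - X]exchange_big/= -sumrB big1// => i _.
  by rewrite -!mulr_suml A_balanced subrr.
rewrite -[RHS]addr0 -[X in _ = _ + X]E -big_split/= /dotp mulr_sumr; apply: eq_bigr => i _.
rewrite laplacianE -big_split/= !mulr_sumr; apply: eq_bigr => j _.
by ring.
Qed.

Hypothesis A_ge0 : forall i j, 0 <= A i j.

Lemma laplacian_form_ge0 x : 0 <= dotp x (L *m x).
Proof.
rewrite -(pmulr_rge0 _ (_ : 0 < 2)) ?laplacian_form ?ltr0n//.
by apply: sumr_ge0 => i _; apply: sumr_ge0 => j _; rewrite mulr_ge0// sqr_ge0.
Qed.

Hypothesis A_connected : strongly_connected A.

Lemma laplacian_form_eq0 x : dotp x (L *m x) = 0 -> forall i j, x i 0 = x j 0.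
Proof.
move=> x0.
have ge0 i j : 0 <= A i j * (x i 0 - x j 0) ^+ 2 by rewrite mulr_ge0// sqr_ge0.
have eqe i j : edge A i j -> x i 0 = x j 0.
  move=> Aij; have : \sum_i \sum_j A i j * (x i 0 - x j 0) ^+ 2 = 0.
    by rewrite -laplacian_form x0 mulr0.
  move/eqP; rewrite psumr_eq0 => [|k _]; last exact: sumr_ge0.
  move=> /allP/(_ i (mem_index_enum i))/=; rewrite psumr_eq0// => /allP.
  move=> /(_ j (mem_index_enum j))/=; rewrite mulf_eq0 gt_eqF//= sqrf_eq0 subr_eq0.
  by move/eqP.
move=> i j; have /connectP[p] := A_connected i j.
elim: p i => [i _ ->//|k p IH i /= /andP[ik kp] jE].
by rewrite (eqe _ _ ik); exact: IH kp jE.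
Qed.

Let form_sym x : dotp x ((L + L^T) *m x) = 2 * dotp x (L *m x).
Proof. by rewrite mulmxDl dotpDr [X in _ + X]dotp_mulmx trmxK dotpC; ring. Qed.

Lemma eigenvalue_laplacian_ge0 l : eigenvalue (L + L^T) l -> 0 <= l.
Proof.
case/eigenvalueP => v vL v0.
have Lv : (L + L^T) *m v^T = l *: v^T.
  rewrite -[L + L^T]trmxK -trmx_mul linearD/= trmxK addrC vL.
  by rewrite linearZ.
have v0' : v^T != 0 by rewrite -(inj_eq (@trmx_inj _ _ _)) trmxK trmx0.
rewrite -(pmulr_lge0 _ (dotp_gt0 v0')) -dotpZr -Lv form_sym.
by rewrite mulr_ge0// laplacian_form_ge0.
Qed.

Lemma lambda2_ge0 : 0 <= lambda2 (L + L^T).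
Proof.
rewrite /lambda2; set S := [set _ | _].
have [->|/set0P S0] := eqVneq S set0; first by rewrite inf0.
by apply: lb_le_inf => // l [/eigenvalue_laplacian_ge0].
Qed.

(** The minimal Rayleigh quotient on vectors of sum zero is an eigenvalue. It is not 0: otherwise
    connectedness would make the eigenvector constant, and its zero sum would make it vanish. Hence
    it belongs to the set whose infimum is [lambda2]. *)
Lemma lambda2_le x : \sum_i x i 0 = 0 ->
  lambda2 (L + L^T) * dotp x x <= 2 * dotp x (L *m x).
Proof.
move=> x1; have [->|x0] := eqVneq x 0.
  by rewrite mulmx0 !dotpE mulmx0 !mxE !mulr0.
have [|||x1' [m [x1'0 ux1' Sx1' mmin]]] := @rayleigh_min _ _ (L + L^T) one x _ _ x0.
- by rewrite linearD/= trmxK addrC.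
- by rewrite mulmxDl laplacian1 tr_laplacian1 addr0.
- by rewrite dotp1.
rewrite -form_sym; apply: le_trans (mmin _ _); last by rewrite dotp1.
rewrite ler_wpM2r ?dotp_ge0//; apply: inf_lbound.
  by exists 0 => l [/eigenvalue_laplacian_ge0].
split.
  apply/eigenvalueP; exists x1'^T; last by rewrite -(inj_eq (@trmx_inj _ _ _)) trmxK trmx0.
  rewrite -[L + L^T]trmxK -trmx_mul linearD/= trmxK addrC Sx1'.
  by rewrite linearZ.
apply/eqP => m0; move: ux1' x1'0; rewrite dotp1.
have /laplacian_form_eq0 xc : dotp x1' (L *m x1') = 0.
  by have := form_sym x1'; rewrite Sx1' m0 scale0r dotpE mulmx0 mxE; lra.
move=> s0 /negP; apply; apply/eqP/matrixP => i j; rewrite ord1 mxE.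
move: s0; rewrite (eq_bigr (fun=> x1' i 0)); last by move=> k _; exact: xc.
rewrite sumr_const => /eqP; rewrite mulrn_eq0 => /orP[|/eqP//].
by rewrite card_ord => /eqP n0; have := ltn_ord i; rewrite [X in (_ < X)%N]n0.
Qed.

End Laplacian.

Section LambdaMax.
Context {R : realType} {n : nat}.
Variable M : 'M[R]_n.
Implicit Types x : 'cV[R]_n.

(** Minimizing the form of [- (M^T *m M)] over the whole sphere gives an eigenvalue [- m] of
    [M^T *m M] that also bounds the spectrum from above, so that the supremum in [lambda_max] is a
    true one. *)
Lemma dotp_mulmx_le_lambda_max x :
  dotp (M *m x) (M *m x) <= lambda_max (M^T *m M) * dotp x x.
Proof.
have [->|x0] := eqVneq x 0; first by rewrite mulmx0 !dotpE !mulmx0 !mxE !mulr0.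
have MM y : dotp y ((M^T *m M) *m y) = dotp (M *m y) (M *m y).
  by rewrite -mulmxA dotp_mulmx trmxK.
have [|||x1 [m [x1_neq0 _ Sx1 mmin]]] := @rayleigh_min _ _ (- (M^T *m M)) 0 x _ _ x0.
- by rewrite linearN/= trmx_mul trmxK.
- by rewrite mulmx0.
- by rewrite dotpE trmx0 mul0mx mxE.
have d0 (y : 'cV[R]_n) : dotp 0 y = 0 by rewrite dotpE trmx0 mul0mx mxE.
have mmax y : dotp (M *m y) (M *m y) <= - m * dotp y y.
  by have := mmin y (d0 y); rewrite mulNmx dotpNr MM; lra.
apply: le_trans (mmax x) _; rewrite ler_wpM2r ?dotp_ge0//; apply: ub_le_sup.
  exists (- m) => l /eigenvalueP[v vM v0].
  have v0' : v^T != 0 by rewrite -(inj_eq (@trmx_inj _ _ _)) trmxK trmx0.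
  rewrite -(ler_pM2r (dotp_gt0 v0')); apply: le_trans (mmax _).
  have Mv : (M^T *m M) *m v^T = l *: v^T.
    by rewrite -linearZ/= -vM trmx_mul trmx_mul trmxK.
  by rewrite -MM Mv dotpZr.
apply/eigenvalueP; exists x1^T; last by rewrite -(inj_eq (@trmx_inj _ _ _)) trmxK trmx0.
apply: trmx_inj; rewrite trmx_mul trmxK trmx_mul trmxK linearZ/= trmxK.
by rewrite -[M^T *m M]opprK mulNmx Sx1 scaleNr.
Qed.

End LambdaMax.

Lemma lambda_max_ge0 (R : realType) n (M : 'M[R]_n) : 'I_n -> 0 <= lambda_max (M^T *m M).
Proof.
move=> i; have x0 : delta_mx i 0 != 0 :> 'cV[R]_n.
  by apply/eqP => /matrixP/(_ i 0)/eqP; rewrite !mxE !eqxx oner_eq0.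
rewrite -(pmulr_lge0 _ (dotp_gt0 x0)); apply: le_trans (dotp_mulmx_le_lambda_max M _).
exact: dotp_ge0.
Qed.

(** * Exactness of the penalty *)

Lemma convex_real_tangent (R : realType) (phi : R -> R) p q : convex_real phi ->
  derivable phi q 1 -> derive1 phi q * (p - q) <= phi p - phi q.
Proof.
move=> cphi dphi; apply/ler_addgt0Pr => e e0.
have pq0 : 0 <= `|p - q| by [].
have pq1 : 0 < `|p - q| + 1 by lra.
have /cvgrPdist_le /(_ _ (divr_gt0 e0 pq1)) :
    h^-1 *: (phi (h *: 1 + q) - phi q) @[h --> 0^'] --> derive1 phi q.
  by rewrite derive1E; exact: dphi.
move=> [d /= d0 hd].
have [->|pq] := eqVneq p q; first by rewrite !subrr mulr0 add0r ltW.
have pq_gt0 : 0 < `|p - q| by rewrite normr_gt0 subr_eq0.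
pose h := Num.min 1 (d / (2 * `|p - q|)).
have h0 : 0 < h by rewrite lt_min ltr01 divr_gt0// mulr_gt0.
have h1 : h <= 1 by rewrite ge_min lexx.
have hpq : h * `|p - q| < d.
  have : h <= d / (2 * `|p - q|) by rewrite ge_min lexx orbT.
  by rewrite ler_pdivlMr ?mulr_gt0//; lra.
have k0 : h * (p - q) != 0 by rewrite mulf_neq0 ?subr_eq0// gt_eqF.
have := hd (h * (p - q)); rewrite /ball_/= sub0r normrN normrM (gtr0_norm h0).
move=> /(_ hpq k0); rewrite /GRing.scale/= mulr1.
set D := derive1 phi q; set c := phi (_ + q) - _ => DC.
have cE : c <= h * (phi p - phi q).
  have := cphi p q h (ltW h0) h1.
  have -> : h * p + (1 - h) * q = h * (p - q) + q by ring.
  by rewrite /c; lra.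
have : `|h * (p - q) * D - c| <= h * `|p - q| * (e / (`|p - q| + 1)).
  have -> : h * (p - q) * D - c = h * (p - q) * (D - (h * (p - q))^-1 * c).
    by rewrite [RHS]mulrBr mulVKf.
  by rewrite normrM normrM (gtr0_norm h0) ler_wpM2l// mulr_ge0// ltW.
have epq : `|p - q| * (e / (`|p - q| + 1)) <= e.
  by rewrite mulrCA ger_pMr// ler_pdivrMr// mul1r; lra.
move=> /ler_normlP[_ DhE].
have : h * (D * (p - q)) <= h * (phi p - phi q + e) by nra.
by rewrite ler_pM2l.
Qed.

Section ExactPenalty.
Context {R : realType} {n : nat}.
Variables (f : 'I_n -> R -> R) (Pl : R) (Pm PM : 'cV[R]_n) (eps : R).
Hypotheses (f_ge0 : forall i x, 0 <= f i x) (f_convex : forall i, convex_real (f i)).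
Hypothesis f_derivable : forall i x, derivable (f i) x 1.
Hypothesis feasible_nonempty : ED_feasible Pl Pm PM !=set0.
Hypothesis eps_gt0 : 0 < eps.
Hypothesis eps_small : (eps%:E < ((2 * max_gradient_norm f Pl Pm PM)%:E)^-1)%E.
Implicit Types P Q S : 'cV[R]_n.

Definition penalized_summand i (x : R) : R :=
  f i x + eps^-1 * (Num.max 0 (x - PM i 0) + Num.max 0 (Pm i 0 - x)).

Lemma penalized_costE : penalized_cost f Pm PM eps = separable penalized_summand.
Proof. by apply/funext => P; rewrite /separable big_split/= -mulr_sumr. Qed.

Lemma penalized_summand_ge0 i x : 0 <= penalized_summand i x.
Proof.
by rewrite addr_ge0// mulr_ge0 ?invr_ge0 ?(ltW eps_gt0)// addr_ge0// le_max lexx.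
Qed.

Lemma penalized_summand_convex i : convex_real (penalized_summand i).
Proof.
apply: convex_realD => //; apply: convex_realZ; first by rewrite invr_ge0 ltW.
apply: convex_realD => x y t t0 t1.
  by have := convex_pos_part 1 (- PM i 0) x y t0 t1; rewrite !mul1r.
by have := convex_pos_part (- 1) (Pm i 0) x y t0 t1; rewrite !mulN1r !(addrC (- _)).
Qed.

(** The supremum dominates its elements only once they are bounded: the tangents at a feasible
    point, evaluated at [K + 1] and [- K - 1] outside the box, bound all slopes by [C] because the
    costs are nonnegative. *)
Lemma max_gradient_norm_bound Q i : ED_feasible Pl Pm PM Q ->
  `|derive1 (f i) (Q i 0)| <= max_gradient_norm f Pl Pm PM.
Proof.
move=> FQ.
have gradE S j : gradient (total_cost f) S j 0 = derive1 (f j) (S j 0).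
  rewrite mxE derive1E /derive; apply: (congr1 (fun g : R -> R => lim (g @ 0^'))).
  apply/funext => h /=.
  congr (_ *: _); rewrite /total_cost -sumrB (bigD1 j)//= big1 => [|k kj]; last first.
    by rewrite !mxE (negbTE kj) mulr0 add0r subrr.
  by rewrite addr0 !mxE !eqxx.
have gradb : has_ubound [set `|gradient (total_cost f) P| | P in ED_feasible Pl Pm PM].
  pose K : R := \sum_j (`|Pm j 0| + `|PM j 0|).
  pose C : R := \sum_j (f j (K + 1) + f j (- K - 1)).
  have C0 : 0 <= C by apply: sumr_ge0 => j _; rewrite addr_ge0.
  exists C => _ [P [PP _] <-]; apply: (@norm_le_coord _ _ _ C C0) => j; rewrite gradE.
  have PjK : `|P j 0| <= K.
    apply: (@le_trans _ _ (`|Pm j 0| + `|PM j 0|)); last first.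
      by rewrite /K (bigD1 j)//= lerDl sumr_ge0// => k _; rewrite addr_ge0.
    have := PP j; rewrite ler_norml; have := ler_norm (PM j 0); have := ler_norm (- Pm j 0).
    rewrite normrN; have : 0 <= `|PM j 0| by []; have : 0 <= `|Pm j 0| by [].
    by move=> ? ? ? ? /andP[? ?]; lra.
  have fC : f j (K + 1) + f j (- K - 1) <= C.
    by rewrite /C (bigD1 j)//= lerDl sumr_ge0// => k _; rewrite addr_ge0.
  move: PjK; rewrite ler_norml => /andP[PK1 PK2].
  have := convex_real_tangent (K + 1) (f_convex j) (@f_derivable j (P j 0)).
  have := convex_real_tangent (- K - 1) (f_convex j) (@f_derivable j (P j 0)).
  have := f_ge0 j (P j 0); have := f_ge0 j (K + 1); have := f_ge0 j (- K - 1).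
  set D := derive1 _ _ => ? ? ? ? ?.
  by rewrite ler_norml; apply/andP; split; [have [|] := leP D 0|have [|] := leP 0 D]; nra.
apply: (@le_trans _ _ `|gradient (total_cost f) Q|).
  by rewrite -gradE coord_le_norm.
by apply: ub_le_sup => //; exists Q.
Qed.

Lemma eps_max_gradient_norm : 2 * max_gradient_norm f Pl Pm PM < eps^-1.
Proof.
have G0 : 0 <= max_gradient_norm f Pl Pm PM \/ max_gradient_norm f Pl Pm PM < 0.
  by case: leP; [left|right].
have einv : 0 < eps^-1 by rewrite invr_gt0.
case: G0 => [G0|]; last by lra.
(* If the maximum is 0, the extended inverse in [eps_small] is infinite and gives nothing, but the
   claim reduces to [0 < eps^-1]. *)
have [G00|G1] := eqVneq (max_gradient_norm f Pl Pm PM) 0; first by rewrite G00 mulr0.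
have G2 : 0 < 2 * max_gradient_norm f Pl Pm PM by rewrite mulr_gt0// lt_def G1.
move: eps_small; rewrite inver gt_eqF// lte_fin => h.
by rewrite -[ltLHS]invrK ltf_pV2 ?posrE ?invr_gt0.
Qed.

Let box Q := forall i, Pm i 0 <= Q i 0 <= PM i 0.

(** [Q] moves along the segment to the corner [PM] or [Pm], according to whether its sum is too
    small or too large. All coordinates move in the same direction, so the l1 distance covered
    equals the change of the sum. *)
Lemma feasible_near_box Q : box Q -> exists2 S, ED_feasible Pl Pm PM S &
  \sum_i `|S i 0 - Q i 0| <= `|\sum_i Q i 0 - Pl|.
Proof.
move=> bQ.
have [F [bF FPl]] := feasible_nonempty.
have move_to T (theta : R) : box T -> 0 <= theta -> theta <= 1 ->
    theta * (\sum_i T i 0 - \sum_i Q i 0) = Pl - \sum_i Q i 0 ->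
    \sum_i `|T i 0 - Q i 0| = `|\sum_i T i 0 - \sum_i Q i 0| ->
    exists2 S, ED_feasible Pl Pm PM S &
      \sum_i `|S i 0 - Q i 0| <= `|\sum_i Q i 0 - Pl|.
  move=> bT t0 t1 tE absE.
  have SE i : (Q + theta *: (T - Q)) i 0 = Q i 0 + theta * (T i 0 - Q i 0).
    by rewrite !mxE.
  exists (Q + theta *: (T - Q)).
    split=> [i|]; first by rewrite SE; have := bT i; have := bQ i; nra.
    rewrite (eq_bigr _ (fun i _ => SE i)) big_split/= -mulr_sumr sumrB tE; ring.
  rewrite distrC -tE normrM -absE (ger0_norm t0) mulr_sumr; apply: ler_sum => i _.
  by rewrite SE [_ + _ * _]addrC addrK normrM (ger0_norm t0).
have [QPl|PlQ] := leP (\sum_i Q i 0) Pl.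
  have PMPl : Pl <= \sum_i PM i 0.
    by rewrite -FPl; apply: ler_sum => i _; case/andP: (bF i).
  pose theta := (Pl - \sum_i Q i 0) / (\sum_i PM i 0 - \sum_i Q i 0).
  have tE : theta * (\sum_i PM i 0 - \sum_i Q i 0) = Pl - \sum_i Q i 0.
    (* A zero denominator means that the sum of [Q] is already [Pl]; then [theta] is 0 by the
       convention on inverses. *)
    rewrite /theta; have [M0|M0] := eqVneq (\sum_i PM i 0 - \sum_i Q i 0) 0.
      by rewrite M0 mulr0; lra.
    by rewrite divfK.
  apply: (move_to PM theta) => //.
  - by move=> i; have := bF i; lra.
  - by apply: divr_ge0; lra.
  - rewrite /theta; have [M0|M0] := eqVneq (\sum_i PM i 0 - \sum_i Q i 0) 0.
      by rewrite M0 invr0 mulr0.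
    by rewrite ler_pdivrMr; [lra|rewrite lt_def M0/=; lra].
  - rewrite -sumrB ger0_norm; last first.
      by apply: sumr_ge0 => i _; have := bQ i; lra.
    by apply: eq_bigr => i _; rewrite ger0_norm//; have := bQ i; lra.
have PmPl : \sum_i Pm i 0 <= Pl.
  by rewrite -FPl; apply: ler_sum => i _; case/andP: (bF i).
pose theta := (Pl - \sum_i Q i 0) / (\sum_i Pm i 0 - \sum_i Q i 0).
have M0 : \sum_i Pm i 0 - \sum_i Q i 0 < 0 by lra.
have tE : theta * (\sum_i Pm i 0 - \sum_i Q i 0) = Pl - \sum_i Q i 0.
  by rewrite divfK// lt_eqF.
apply: (move_to Pm theta) => //.
- by move=> i; have := bF i; lra.
- by nra.
- by nra.
- rewrite -sumrB ler0_norm; last first.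
    by rewrite sumrB ltW.
  rewrite -sumrN; apply: eq_bigr => i _; rewrite ler0_norm//; have := bQ i; lra.
Qed.

(* Clip P to the box and move the clipped point back to the hyperplane; this
   costs at most twice the total violation in the l1 norm. *)
Lemma exact_penalty (r : 'I_n) P : \sum_i P i 0 = Pl ->
  (forall Q, ED_feasible Pl Pm PM Q -> penalized_cost f Pm PM eps P <= total_cost f Q) ->
  ED_solutions f Pl Pm PM P.
Proof.
move=> PPl Pmin.
have [F [bF FPl]] := feasible_nonempty.
pose a i := Num.max 0 (P i 0 - PM i 0); pose b i := Num.max 0 (Pm i 0 - P i 0).
have a0 i : 0 <= a i by rewrite le_max lexx.
have b0 i : 0 <= b i by rewrite le_max lexx.
pose Q : 'cV[R]_n := \col_i (P i 0 - a i + b i).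
have bQ : box Q.
  move=> i; have := bF i; rewrite mxE /a /b.
  by case: (leP 0 (P i 0 - PM i 0)); case: (leP 0 (Pm i 0 - P i 0)); lra.
have [S FS SQ] := feasible_near_box bQ.
have A0 : 0 <= \sum_i a i by exact: sumr_ge0.
have B0 : 0 <= \sum_i b i by exact: sumr_ge0.
have QPl : \sum_i Q i 0 - Pl = \sum_i b i - \sum_i a i.
  rewrite -PPl -!sumrB; apply: eq_bigr => i _; rewrite mxE; ring.
set G := max_gradient_norm f Pl Pm PM.
have G0 : 0 <= G by apply: le_trans (max_gradient_norm_bound r FS); exact: normr_ge0.
(* The tangent is taken at [S], since the gradient bound holds on the feasible set only. *)
have fSP : total_cost f S - total_cost f P <= G * \sum_i `|S i 0 - P i 0|.
  rewrite -sumrB mulr_sumr; apply: ler_sum => i _.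
  have := convex_real_tangent (P i 0) (f_convex i) (@f_derivable i (S i 0)).
  have := max_gradient_norm_bound i FS; rewrite -/G.
  set D := derive1 _ _ => DG DE.
  have : D * (S i 0 - P i 0) <= `|D| * `|S i 0 - P i 0|.
    by rewrite -normrM ler_norm.
  have : `|D| * `|S i 0 - P i 0| <= G * `|S i 0 - P i 0| by rewrite ler_wpM2r.
  by lra.
have SP : \sum_i `|S i 0 - P i 0| <= 2 * (\sum_i a i + \sum_i b i).
  apply: (@le_trans _ _ (\sum_i `|S i 0 - Q i 0| + (\sum_i a i + \sum_i b i))).
    rewrite -!big_split/=; apply: ler_sum => i _.
    apply: le_trans (ler_distD (Q i 0) _ _) _; rewrite lerD2l mxE.
    have -> : P i 0 - a i + b i - P i 0 = b i - a i by ring.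
    by rewrite ler_norml; have := a0 i; have := b0 i; lra.
  move: SQ; rewrite QPl => SQ.
  have : `|\sum_i b i - \sum_i a i| <= \sum_i a i + \sum_i b i.
    by rewrite ler_norml; lra.
  by lra.
(* With T the total violation, f(P) + T / eps <= f(S) <= f(P) + 2 G T, while 2 G < 1 / eps; hence T
   = 0. *)
have AB0 : \sum_i a i + \sum_i b i = 0.
  have := Pmin S FS; rewrite /penalized_cost big_split/=.
  rewrite -/(total_cost f P) -/(a _) -/(b _).
  have := eps_max_gradient_norm; rewrite -/G.
  have : G * \sum_i `|S i 0 - P i 0| <= G * (2 * (\sum_i a i + \sum_i b i)).
    by rewrite ler_wpM2l.
  move: (eps^-1) (\sum_i a i) (\sum_i b i) A0 B0 fSP => E AA BB; nra.
have ai i : a i = 0.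
  have : \sum_i a i = 0 by lra.
  by move/eqP; rewrite psumr_eq0// => /allP /(_ i (mem_index_enum i)) /eqP.
have bi i : b i = 0.
  have : \sum_i b i = 0 by lra.
  by move/eqP; rewrite psumr_eq0// => /allP /(_ i (mem_index_enum i)) /eqP.
split.
  split=> // i; have := ai i; have := bi i; rewrite /a /b.
  by case: (leP 0 (P i 0 - PM i 0)); case: (leP 0 (Pm i 0 - P i 0)); lra.
move=> T FT; apply: le_trans (Pmin T FT); rewrite lerDl mulr_ge0//.
  by rewrite invr_ge0 ltW.
by apply: sumr_ge0 => i _; exact: (addr_ge0 (a0 i) (b0 i)).
Qed.

Lemma ED_solutions_nonempty : ED_solutions f Pl Pm PM !=set0.
Proof.
have tcC : continuous (total_cost f) by exact: (separable_continuous f_ge0 f_convex).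
have cK : compact (ED_feasible Pl Pm PM).
  apply: col_bounded_closed_compact.
    exists (\sum_j (`|Pm j 0| + `|PM j 0|)); split; first exact: num_real.
    move=> N KN P [bP _]; apply: norm_le_coord => [|i].
      by apply: le_trans (ltW KN); apply: sumr_ge0 => j _; rewrite addr_ge0.
    apply: (le_trans _ (ltW KN)); rewrite (bigD1 i)//=.
    have : 0 <= \sum_(j | j != i) (`|Pm j 0| + `|PM j 0|).
      by apply: sumr_ge0 => j _; rewrite addr_ge0.
    have := bP i; rewrite ler_norml; have := ler_norm (PM i 0); have := ler_norm (- Pm i 0).
    rewrite normrN; have : 0 <= `|PM i 0| by []; have : 0 <= `|Pm i 0| by [].
    by move=> ? ? ? ? /andP[? ?] ?; lra.
  rewrite (_ : ED_feasible _ _ _ = (\bigcap_(i in setT) ((fun P : 'cV[R]_n => P i 0) @^-1`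
      [set x | Pm i 0 <= x])) `&` (\bigcap_(i in setT) ((fun P : 'cV[R]_n => P i 0) @^-1`
      [set x | x <= PM i 0])) `&` (dotp (const_mx 1) @^-1` [set Pl])); last first.
    apply/seteqP; split => P /=.
      move=> [bP sP]; split; last by rewrite dotp1.
      by split => i _; case/andP: (bP i).
    by rewrite dotp1 => -[[P1 P2] sP]; split => // i; apply/andP; split; [exact: P1|exact: P2].
  apply: closedI; [apply: closedI|].
  - apply: closed_bigI => i _; apply: closed_comp; last exact: closed_ge.
    by move=> P _; exact: coord_continuous.
  - apply: closed_bigI => i _; apply: closed_comp; last exact: closed_le.
    by move=> P _; exact: coord_continuous.
  - apply: closed_comp; last exact: closed_eq.
    move=> P _; apply: dotp_continuous; first exact: cst_continuous.
    by move=> ?; exact: cvg_id.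
have [P /set_mem FP Pmin] := compact_EVT_min feasible_nonempty cK
  (continuous_subspaceT tcC).
by exists P; split => // Q FQ; apply: Pmin; exact: mem_set.
Qed.

(** Converts convergence of values into convergence of points. On the compact set of points of the
    ball at distance at least [eta] from every solution, the continuous [Phi] is positive by
    exactness of the penalty, and half its minimum is [delta]. The gap is truncated at 0 because off
    the hyperplane the cost may lie below the optimal value. *)
Lemma near_ED_solutions (r : 'I_n) S0 (B eta : R) : 0 < eta -> 0 <= B ->
  ED_solutions f Pl Pm PM S0 ->
  exists2 delta : R, 0 < delta & forall P, `|P| <= B ->
    `|\sum_i P i 0 - Pl| < delta ->
    Num.max 0 (penalized_cost f Pm PM eps P - total_cost f S0) < delta ->
    exists2 S, ED_solutions f Pl Pm PM S & `|P - S| < eta.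
Proof.
move=> eta0 B0 [FS0 S0min].
have normC (S : 'cV[R]_n) : continuous (fun P : 'cV[R]_n => `|P - S|).
  apply: (@lipschitz_continuous _ 'cV[R]_n R^o _ 1) => x y; rewrite mul1r.
  apply: le_trans (ler_dist_dist _ _) _.
  by rewrite opprB addrA subrK.
pose K := [set P | `|P| <= B /\ forall S, ED_solutions f Pl Pm PM S -> eta <= `|P - S|].
have cK : compact K.
  apply: col_bounded_closed_compact.
    exists B; split; first exact: num_real.
    by move=> N BN P [PB _]; exact: le_trans PB (ltW BN).
  rewrite (_ : K = ((fun P : 'cV[R]_n => `|P - 0|) @^-1` [set x | x <= B]) `&`
     (\bigcap_(S in ED_solutions f Pl Pm PM) ((fun P : 'cV[R]_n => `|P - S|) @^-1`
        [set x | eta <= x]))); last first.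
    by apply/seteqP; split => P; rewrite /K/= subr0.
  apply: closedI; first by apply: closed_comp; [move=> ? _; exact: normC|exact: closed_le].
  by apply: closed_bigI => S _; apply: closed_comp; [move=> ? _; exact: normC|exact: closed_ge].
pose Phi P := `|\sum_i P i 0 - Pl| + Num.max 0 (penalized_cost f Pm PM eps P - total_cost f S0).
have PhiC : continuous Phi.
  have sC : continuous (fun P : 'cV[R]_n => \sum_i P i 0 - Pl).
    move=> P; apply: continuousB; last exact: cst_continuous.
    rewrite (_ : (fun _ => _) = dotp (const_mx 1)); last first.
      by apply/funext => ?; rewrite dotp1.
    apply: dotp_continuous; first exact: cst_continuous.
    by move=> ?; exact: cvg_id.
  have pC : continuous (fun P => penalized_cost f Pm PM eps P - total_cost f S0).
    move=> P; apply: continuousB; last exact: cst_continuous.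
    rewrite penalized_costE.
    exact: (separable_continuous penalized_summand_ge0 penalized_summand_convex).
  have nC : continuous (fun P : 'cV[R]_n => `|\sum_i P i 0 - Pl|).
    by move=> P; apply: (continuous_comp (sC P)); exact: norm_continuous.
  have mC : continuous (fun P => Num.max 0 (penalized_cost f Pm PM eps P - total_cost f S0)).
    move=> P; apply: (@continuous_max _ _ (cst 0) _ P); first exact: cst_continuous.
    exact: pC.
  by move=> P; exact: (continuousD (nC P) (mC P)).
have max_ge0 (x : R) : 0 <= Num.max 0 x by rewrite le_max lexx.
have [K0|K0] := pselect (K !=set0); last first.
  exists 1 => // P PB _ _; apply: contrapT => h; apply: K0; exists P; split => // S SS.
  by rewrite leNgt; apply/negP => PS; apply: h; exists S.
have [c /set_mem[cB cS] cmin] := compact_EVT_min K0 cK (continuous_subspaceT PhiC).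
have Phic : 0 < Phi c.
  rewrite lt_neqAle addr_ge0// andbT eq_sym; apply/negP => /eqP Phic.
  have c1 : `|\sum_i c i 0 - Pl| = 0.
    apply/eqP; rewrite eq_le normr_ge0 andbT.
    by move: Phic; rewrite /Phi; have := max_ge0 (penalized_cost f Pm PM eps c - total_cost f S0); lra.
  have c2 : penalized_cost f Pm PM eps c - total_cost f S0 <= 0.
    have : Num.max 0 (penalized_cost f Pm PM eps c - total_cost f S0) <= 0.
      by move: Phic; rewrite /Phi c1; lra.
    by rewrite ge_max => /andP[].
  have sc : ED_solutions f Pl Pm PM c.
    apply: exact_penalty => //; first by move/eqP: c1; rewrite normr_eq0 subr_eq0 => /eqP.
    by move=> Q FQ; have := S0min _ FQ; lra.
  by have := cS _ sc; rewrite subrr normr0; lra.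
exists (Phi c / 2); first by rewrite divr_gt0.
move=> P PB P1 P2; apply: contrapT => h.
have KP : K P.
  split => // S SS; rewrite leNgt; apply/negP => PS; apply: h; by exists S.
by have := cmin _ (mem_set KP); rewrite /Phi in P1 P2 *; lra.
Qed.

End ExactPenalty.

(** * The Lyapunov function along trajectories *)

Section PerturbedLyapunov.
Context {R : realType}.
Variables (V : R -> R) (C k : R).
Hypotheses (C_ge0 : 0 <= C) (k_gt0 : 0 < k).
Hypothesis Vac : forall T : R, 0 <= T -> abs_continuous_on 0 T V.

(* [C / k * exp(- k t)] is the integral of the perturbation over [t, +oo[. *)
Let W t := V t + C / k * expR (- k * t).

Let Wac (T : R) : 0 <= T -> abs_continuous_on 0 T W.
Proof.
move=> T0; apply: abs_continuousD; first exact: Vac.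
apply: abs_continuousZ; exact: abs_continuous_expR.
Qed.

Let W_dini (t D : R) : left_dini_le V t (D + C * expR (- k * t)) -> left_dini_le W t D.
Proof.
move=> VD; have := left_dini_leD VD (is_derive_left_dini
  (is_deriveZ (C / k) (is_derive_expR_scale (- k) t))).
apply: left_dini_leW; rewrite /GRing.scale/= le_eqVlt; apply/orP; left; apply/eqP.
by field; rewrite gt_eqF.
Qed.

Lemma perturbed_lyapunov_bounded :
  {ae (@lebesgue_measure R), forall t, 0 < t -> left_dini_le V t (C * expR (- k * t))} ->
  forall t, 0 <= t -> V t <= V 0 + C / k.
Proof.
move=> VD t t0; apply: (@le_trans _ _ (W t)).
  by rewrite lerDl mulr_ge0 ?expR_ge0// divr_ge0// ltW.
have -> : V 0 + C / k = W 0 by rewrite /W mulr0 expR0 mulr1.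
rewrite -subr_le0 -[leRHS](mul0r (t - 0)); apply: abs_continuous_increment_le => //.
  exact: Wac.
apply: lebesgue_aeS VD => s + /andP[s0 _] => /(_ s0) h.
by apply: W_dini; rewrite add0r.
Qed.

Lemma perturbed_barbalat (q : R -> R) (c M : R) : 0 < c -> 0 < M ->
  (forall t, 0 <= t -> 0 <= V t) ->
  (forall s t, 0 <= s -> s <= t -> `|q t - q s| <= M * (t - s)) ->
  {ae (@lebesgue_measure R), forall t, 0 < t ->
    left_dini_le V t (- c * q t ^+ 2 + C * expR (- k * t))} ->
  q t @[t --> +oo] --> (0 : R).
Proof.
move=> c0 M0 V0 qM VD; apply: (@barbalat _ W q c M) => //.
  move=> t t0; apply: addr_ge0; first exact: V0.
  by rewrite mulr_ge0 ?expR_ge0// divr_ge0// ltW.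
by apply: lebesgue_aeS VD => t + t0 => /(_ t0); exact: W_dini.
Qed.

End PerturbedLyapunov.

Lemma sqr_dotpD {R : realType} {n : nat} (x y : 'cV[R]_n) (k : R) :
  dotp (x + k *: y) (x + k *: y) = dotp x x + 2 * k * dotp x y + k ^+ 2 * dotp y y.
Proof. by rewrite !(dotpDl, dotpDr, dotpZl, dotpZr) (dotpC y x); ring. Qed.

(** * Splitting a vector into its mean and its centered part *)

Section Centering.
Context {R : realType} {n : nat}.
Implicit Types x y : 'cV[R]_n.

Definition mean x : R := (\sum_i x i 0) / n%:R.

Definition center x : 'cV[R]_n := x - const_mx (mean x).

Definition enorm x : R := Num.sqrt (dotp x x).

Lemma enorm_ge0 x : 0 <= enorm x. Proof. exact: sqrtr_ge0. Qed.

Lemma sqr_enorm x : enorm x ^+ 2 = dotp x x.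
Proof. by rewrite sqr_sqrtr ?dotp_ge0. Qed.

Lemma coord_le_enorm x i : `|x i 0| <= enorm x.
Proof. by rewrite -sqrtr_sqr ler_wsqrtr// sqr_coord_le_dotp. Qed.

(** The index [r] witnesses that n is positive, so that the division in [mean] is a true one. *)
Lemma sum_mean (r : 'I_n) x : \sum_i x i 0 = n%:R * mean x.
Proof.
by rewrite mulrC divfK// pnatr_eq0; apply/eqP => n0; have := ltn_ord r; rewrite [X in (_ < X)%N]n0.
Qed.

Lemma sum_center (r : 'I_n) x : \sum_i center x i 0 = 0.
Proof.
rewrite (eq_bigr (fun i => x i 0 - mean x)); last by move=> i _; rewrite !mxE.
by rewrite sumrB sumr_const card_ord -mulr_natl (sum_mean r) subrr.
Qed.

Lemma dotp_center_mean x y : dotp x y = dotp (center x) y + mean x * \sum_i y i 0.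
Proof.
rewrite /dotp mulr_sumr -big_split; apply: eq_bigr => i _ /=.
by rewrite !mxE; ring.
Qed.

Lemma dotp_center_l x y : \sum_i y i 0 = 0 -> dotp (center x) y = dotp x y.
Proof. by move=> y0; rewrite [RHS]dotp_center_mean y0 mulr0 addr0. Qed.

Lemma dotp_center (r : 'I_n) x y :
  dotp x y = dotp (center x) (center y) + mean x * \sum_i y i 0.
Proof.
rewrite dotp_center_mean; congr (_ + _).
by rewrite dotpC -(dotp_center_l y (sum_center r x)) dotpC.
Qed.

End Centering.

(* The two squares below are minimized by [k = 1 / (th nu2 beta lam)] and
   [l = nu2 / (2 th alpha)]. *)
Lemma weighted_young (R : realType) (alpha beta nu1 nu2 lam Lam th a b d p q e : R) :
  0 < alpha -> 0 < beta -> 0 < nu1 -> 0 < nu2 -> 0 < lam -> 0 < th ->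
  (forall k, 0 <= b - 2 * k * p + k ^+ 2 * a) ->
  (forall l, 0 <= d + 2 * l * q + l ^+ 2 * e) -> e <= Lam * a ->
  nu1 * p - nu2 * q <= th * (nu1 * nu2 * beta * lam / 2) * b + th * alpha * d
    + (nu1 / (beta * nu2 * lam) + nu2 ^+ 2 * Lam / (2 * alpha)) / th / 2 * a.
Proof.
move=> alpha0 beta0 nu10 nu20 lam0 th0 kp lq eLam.
have h1 : 0 <= nu1 / 2 * (th * nu2 * beta * lam) *
    (b - 2 * (th * nu2 * beta * lam)^-1 * p + (th * nu2 * beta * lam)^-1 ^+ 2 * a).
  by rewrite mulr_ge0 ?kp// !mulr_ge0// ltW// invr_gt0.
have h2 : 0 <= th * alpha * (d + 2 * (nu2 / (2 * th * alpha)) * q +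
    (nu2 / (2 * th * alpha)) ^+ 2 * e).
  by rewrite mulr_ge0 ?lq// mulr_ge0// ltW.
have h3 : nu2 ^+ 2 / (4 * th * alpha) * e <= nu2 ^+ 2 / (4 * th * alpha) * (Lam * a).
  by rewrite ler_wpM2l// divr_ge0 ?sqr_ge0// !mulr_ge0// ltW.
have E1 : nu1 / 2 * (th * nu2 * beta * lam) *
    (b - 2 * (th * nu2 * beta * lam)^-1 * p + (th * nu2 * beta * lam)^-1 ^+ 2 * a) =
  th * (nu1 * nu2 * beta * lam / 2) * b - nu1 * p + nu1 / (beta * nu2 * lam) / th / 2 * a.
  by field; rewrite !gt_eqF.
have E2 : th * alpha * (d + 2 * (nu2 / (2 * th * alpha)) * q +
    (nu2 / (2 * th * alpha)) ^+ 2 * e) =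
  th * alpha * d + nu2 * q + nu2 ^+ 2 / (4 * th * alpha) * e.
  by field; rewrite !gt_eqF.
have E3 : nu2 ^+ 2 / (4 * th * alpha) * (Lam * a) =
    nu2 ^+ 2 * Lam / (2 * alpha) / th / 2 * a.
  by field; rewrite !gt_eqF.
rewrite E1 in h1; rewrite E2 in h2; rewrite E3 in h3.
by rewrite [(nu1 / _ + _) / th]mulrDl [(nu1 / _ / th + _) / 2]mulrDl [(nu1 / _ / th / 2 + _) * a]mulrDl; lra.
Qed.

(** * The dissipation inequality *)

Section Dissipation.
Context {R : realType} {n : nat}.
Variables (A : 'M[R]_n) (r : 'I_n) (alpha beta nu1 nu2 : R).
Hypotheses (A_ge0 : forall i j, 0 <= A i j) (A_connected : strongly_connected A)
  (A_balanced : weight_balanced A).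
Hypotheses (alpha_gt0 : 0 < alpha) (beta_gt0 : 0 < beta) (nu1_gt0 : 0 < nu1)
  (nu2_gt0 : 0 < nu2).
Let L := laplacian A.
Hypothesis gains :
  nu1 / (beta * nu2 * lambda2 (L + L^T))
    + nu2 ^+ 2 * lambda_max (L^T *m L) / (2 * alpha)
  < lambda2 (L + L^T).
Implicit Types zeta z w : 'cV[R]_n.

Lemma laplacian_center zeta : L *m zeta = L *m center zeta.
Proof.
rewrite mulmxBr (_ : const_mx _ = mean zeta *: const_mx 1 :> 'cV[R]_n); last first.
  by apply/matrixP => i j; rewrite !mxE mulr1.
by rewrite -scalemxAr laplacian1 scaler0 subr0.
Qed.

(** The left side is V' with zeta . P' in place of the derivative of the cost. [L] controls centered
    parts only, so the sum of z is left over: multiplied by the mean of zeta it comes from nu1 zeta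
    . z, and squared it completes |z~|^2 to |z|^2. *)
Lemma dissipation : exists2 c : R, 0 < c & forall zeta z w,
  dotp zeta (- (L *m zeta) + nu1 *: z)
    + nu1 * nu2 * dotp z (- (beta *: (L *m z)) - w)
    + dotp w (- (nu2 *: (L *m zeta)) + (nu1 * nu2) *: z - alpha *: w)
  <= - c * (dotp (center zeta) (center zeta) + dotp z z + dotp w w)
     + nu1 * mean zeta * (\sum_i z i 0) + c * (\sum_i z i 0) ^+ 2.
Proof.
have lam0 := lambda2_ge0 A_balanced A_ge0.
have Lam0 := lambda_max_ge0 (laplacian A) r.
move: gains lam0; rewrite -/L.
set lam := lambda2 _; set Lam := lambda_max _ => gains' lam0.
(* At [lam = 0] the first quotient is 0 by the convention on inverses, and the gain condition would
   place a nonnegative number below 0. *)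
have {}lam0 : 0 < lam.
  rewrite lt_neqAle lam0 andbT; apply/eqP => lamE; move: gains'.
  rewrite -lamE mulr0 invr0 mulr0 add0r ltNge => /negP; apply.
  by rewrite divr_ge0// ?mulr_ge0// ?sqr_ge0// ltW.
set X := _ + _ in gains'.
have X0 : 0 <= X.
  by rewrite /X addr_ge0// divr_ge0// ?mulr_ge0// ?sqr_ge0// ltW.
(* The midpoint of [X / lam] and 1. A fraction [th] of the damping of z and w pays for the cross
   terms; the remaining [1 - th] and [lam - X / th] give [c]. *)
pose th := (X + lam) / (2 * lam).
have th0 : 0 < th by rewrite divr_gt0//; lra.
have th1 : th < 1 by rewrite ltr_pdivrMr ?mulr_gt0//; lra.
have Xth : X / th < lam.
  rewrite ltr_pdivrMr// /th mulrA ltr_pdivlMr ?mulr_gt0//; nra.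
clearbody th.
pose c := Num.min ((lam - X / th) / 2) (Num.min ((1 - th) * (nu1 * nu2 * beta * lam / 2))
  ((1 - th) * alpha)).
have nnbl : 0 < nu1 * nu2 * beta * lam by rewrite !mulr_gt0.
have c0 : 0 < c.
  rewrite !lt_min; apply/andP; split; first lra.
  have th2 : 0 < 1 - th by rewrite subr_gt0.
  by rewrite !mulr_gt0// invr_gt0.
have c1 : c <= (lam - X / th) / 2 by rewrite ge_min lexx.
have c2 : c <= (1 - th) * (nu1 * nu2 * beta * lam / 2).
  by rewrite !ge_min lexx !orbT.
have c3 : c <= (1 - th) * alpha by rewrite !ge_min lexx !orbT.
exists c => // zeta z w.
have n1 : 1 <= n%:R :> R by rewrite ler1n; apply: leq_ltn_trans (ltn_ord r).
pose a := dotp (center zeta) (center zeta); pose b := dotp (center z) (center z).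
pose d := dotp w w; pose p := dotp (center zeta) (center z).
pose q := dotp w (L *m center zeta).
pose e := dotp (L *m center zeta) (L *m center zeta).
pose m := \sum_i z i 0.
have a0 : 0 <= a by exact: dotp_ge0.
have b0 : 0 <= b by exact: dotp_ge0.
have d0 : 0 <= d by exact: dotp_ge0.
have s1 : lam * a <= 2 * dotp (center zeta) (L *m center zeta).
  by apply: lambda2_le => //; exact: sum_center.
have s2 : lam * b <= 2 * dotp (center z) (L *m center z).
  by apply: lambda2_le => //; exact: sum_center.
have eLam : e <= Lam * a by exact: dotp_mulmx_le_lambda_max.
have zLz x : dotp x (L *m x) = dotp (center x) (L *m center x).
  by rewrite laplacian_center -(dotp_center_l x)// -laplacian_center sum_laplacian.
have zE : dotp z z <= b + m ^+ 2.
  rewrite (dotp_center r) lerD2l -/m /mean -/m mulrAC -expr2 ler_pdivrMr; last lra.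
  by have := sqr_ge0 m; nra.
have kp (k : R) : 0 <= b - 2 * k * p + k ^+ 2 * a.
  have := dotp_ge0 (center z + (- k) *: center zeta).
  by rewrite sqr_dotpD [dotp (center z) (center zeta)]dotpC -/a -/b -/p; lra.
have lq (l : R) : 0 <= d + 2 * l * q + l ^+ 2 * e.
  by have := dotp_ge0 (w + l *: (L *m center zeta)); rewrite sqr_dotpD -/d -/e -/q; lra.
have h3 := weighted_young alpha_gt0 beta_gt0 nu1_gt0 nu2_gt0 lam0 th0 kp lq eLam.
rewrite -/X in h3.
have -> : dotp zeta (- (L *m zeta) + nu1 *: z)
    + nu1 * nu2 * dotp z (- (beta *: (L *m z)) - w)
    + dotp w (- (nu2 *: (L *m zeta)) + (nu1 * nu2) *: z - alpha *: w) =
  - dotp (center zeta) (L *m center zeta) + nu1 * (p + mean zeta * m)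
  - nu1 * nu2 * beta * dotp (center z) (L *m center z) - alpha * d - nu2 * q.
  rewrite !(dotpDr, dotpNr, dotpZr) (dotp_center r zeta z) -/m -/p -!zLz.
  rewrite (dotpC z w) -/d (laplacian_center zeta) -/q.
  rewrite -laplacian_center; ring.
rewrite -/a -/d -/m.
have h4 : nu1 * nu2 * beta * (lam * b / 2) <= nu1 * nu2 * beta * dotp (center z) (L *m center z).
  by rewrite ler_wpM2l ?mulr_ge0 ?(ltW nu1_gt0) ?(ltW nu2_gt0) ?(ltW beta_gt0)//; lra.
have h5 : c * a <= (lam - X / th) / 2 * a by rewrite ler_wpM2r.
have h6 : c * b <= (1 - th) * (nu1 * nu2 * beta * lam / 2) * b by rewrite ler_wpM2r.
have h7 : c * d <= (1 - th) * alpha * d by rewrite ler_wpM2r.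
have h8 : c * dotp z z <= c * (b + m ^+ 2) by rewrite ler_wpM2l// ltW.
move: (X / th) Xth c1 h3 h5 => Xt Xth c1 h3 h5.
by lra.
Qed.

End Dissipation.

Lemma is_derive_coord (R : realType) n (x : R -> 'cV[R]_n) (t : R) (d : 'cV[R]_n) i :
  derivable x t 1 -> derive1 x t = d -> is_derive t 1 (fun s => x s i 0) (d i 0).
Proof.
move=> dx <-; apply: DeriveDef; first by move/derivable_mxP : dx; apply.
by rewrite derive1E derive_mx// mxE.
Qed.

Lemma is_derive_sum_fun (R : realType) n (h : 'I_n -> R -> R) (t : R) (d : 'I_n -> R) :
  (forall i, is_derive t 1 (h i) (d i)) ->
  is_derive t 1 (fun s => \sum_i h i s) (\sum_i d i).
Proof.
move=> hd; rewrite (_ : (fun s => _) = \sum_i h i); last first.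
  by apply/funext => s; rewrite fct_sumE.
exact: is_derive_sum.
Qed.

Lemma is_derive_dotp (R : realType) n (x y : R -> 'cV[R]_n) (t : R) (dx dy : 'cV[R]_n) :
  (forall i, is_derive t 1 (fun s => x s i 0) (dx i 0)) ->
  (forall i, is_derive t 1 (fun s => y s i 0) (dy i 0)) ->
  is_derive t 1 (fun s => dotp (x s) (y s)) (dotp dx (y t) + dotp (x t) dy).
Proof.
move=> xd yd; rewrite -big_split/=; apply: is_derive_sum_fun => i.
apply: (is_derive_eq (is_deriveM (xd i) (yd i))).
by rewrite /GRing.scale/= addrC [_ * dx i 0]mulrC.
Qed.

Lemma exists_le_of_sum_le (R : realType) n (r : 'I_n) (x : 'I_n -> R) (K : R) :
  0 <= K -> \sum_i x i <= K -> exists i, x i <= K.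
Proof.
move=> K0 xK; apply: contrapT => h.
have xi i : K < x i by rewrite ltNge; apply/negP => xi; apply: h; exists i.
suff : K < \sum_i x i by rewrite ltNge xK.
rewrite (bigD1 r)//=; apply: lt_le_trans (xi r) _; rewrite lerDl.
by apply: sumr_ge0 => i _; apply: le_trans K0 (ltW (xi i)).
Qed.

(* If the sum of the P i is bounded, some coordinate is bounded above and some
   coordinate is bounded below; there the subgradient is bounded on one side. *)
Lemma clarke_mean_le (R : realType) n (r : 'I_n) (phi : 'I_n -> R -> R)
    (phi_ge0 : forall i x, 0 <= phi i x) (phi_convex : forall i, convex_real (phi i))
    (Q zeta : 'cV[R]_n) (K : R) : 0 <= K -> `|\sum_i Q i 0| <= K ->
  clarke_gradient (separable phi) Q zeta ->
  `|mean zeta| <= \sum_i (phi i (K + 1) + phi i (- K - 1)) + enorm (center zeta).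
Proof.
move=> K0 /ler_normlP[QK1 QK2] zQ.
set C := \sum_i _.
have C1 i : phi i (K + 1) <= C /\ phi i (- K - 1) <= C.
  rewrite /C (bigD1 i)//=.
  have : 0 <= \sum_(j < n | j != i) (phi j (K + 1) + phi j (- K - 1)).
    by apply: sumr_ge0 => j _; rewrite addr_ge0.
  by have := phi_ge0 i (K + 1); have := phi_ge0 i (- K - 1); lra.
have meanE i : mean zeta = zeta i 0 - center zeta i 0 by rewrite !mxE; ring.
have [i Qi] := exists_le_of_sum_le r K0 QK2.
have [j Qj] : exists j, - Q j 0 <= K.
  by apply: (exists_le_of_sum_le r K0); rewrite sumrN.
have := clarke_gradient_le phi_ge0 phi_convex zQ Qi.
have := clarke_gradient_ge phi_ge0 phi_convex zQ (_ : - K <= Q j 0).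
move=> /(_ ltac:(lra)) zj zi.
have /ler_normlP[ci _] := coord_le_enorm (center zeta) i.
have /ler_normlP[_ cj] := coord_le_enorm (center zeta) j.
rewrite ler_norml; apply/andP; split.
  by rewrite (meanE j); have := C1 j; lra.
by rewrite (meanE i); have := C1 i; lra.
Qed.

Lemma mulmx_coord_le (R : realType) n (M : 'M[R]_n) (x : 'cV[R]_n) (B : R) i :
  0 <= B -> (forall j, `|x j 0| <= B) ->
  `|(M *m x) i 0| <= (\sum_i \sum_j `|M i j|) * B.
Proof.
move=> B0 xB; rewrite mxE; apply: le_trans (ler_norm_sum _ _ _) _.
apply: (@le_trans _ _ (\sum_j `|M i j| * B)).
  by apply: ler_sum => j _; rewrite normrM ler_wpM2l.
rewrite -mulr_suml ler_wpM2r// [leRHS](bigD1 i)//= lerDl.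
by apply: sumr_ge0 => k _; exact: sumr_ge0.
Qed.

Lemma max0_contract (R : realDomainType) (x y : R) :
  `|Num.max 0 x - Num.max 0 y| <= `|x - y|.
Proof.
have := ler_norm (x - y); have := ler_norm (y - x); rewrite (distrC y).
by case: (leP 0 x); case: (leP 0 y) => *; rewrite ler_norml; lra.
Qed.

(** * Decay, bounds and limits along a trajectory *)

Section Trajectory.
Context {R : realType} {n : nat}.
Variables (A : 'M[R]_n) (f : 'I_n -> R -> R) (Pl : R) (Pm PM : 'cV[R]_n).
Variables (r : 'I_n) (eps alpha beta nu1 nu2 : R).
Hypotheses (A_ge0 : forall i j, 0 <= A i j) (A_connected : strongly_connected A)
  (A_balanced : weight_balanced A).
Hypotheses (f_ge0 : forall i x, 0 <= f i x) (f_convex : forall i, convex_real (f i)).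
Hypothesis eps_gt0 : 0 < eps.
Hypotheses (alpha_gt0 : 0 < alpha) (beta_gt0 : 0 < beta) (nu1_gt0 : 0 < nu1)
  (nu2_gt0 : 0 < nu2).
Let L := laplacian A.
Hypothesis gains :
  nu1 / (beta * nu2 * lambda2 (L + L^T))
    + nu2 ^+ 2 * lambda_max (L^T *m L) / (2 * alpha)
  < lambda2 (L + L^T).
Variables P z v : R -> 'cV[R]_n.
Hypothesis v0 : \sum_i v 0 i 0 = 0.
Hypothesis traj : trajectory L f Pl Pm PM eps r alpha beta nu1 nu2 P z v.

Let phi := penalized_summand f Pm PM eps.
Let phi_ge0 := penalized_summand_ge0 Pm PM f_ge0 eps_gt0.
Let phi_convex := penalized_summand_convex Pm PM f_convex eps_gt0.

(* In the coordinates (P, z, w) the equilibria are the points with z = w = 0 and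
   the cross terms between z and w cancel in the energy. *)
Definition residual t := v t - mismatch Pl r nu2 (P t) + alpha *: z t.
Let w := residual.

(** The system in the coordinates (P, z, w), in which v' + alpha z' = - alpha w. The equation for v
    is kept for the conservation of its sum. *)
Lemma flow : {ae (@lebesgue_measure R), forall t, 0 < t ->
  exists zeta, [/\ clarke_gradient (separable phi) (P t) zeta,
    forall i, is_derive t 1 (fun s => P s i 0) ((- (L *m zeta) + nu1 *: z t) i 0),
    forall i, is_derive t 1 (fun s => z s i 0) ((- (beta *: (L *m z t)) - w t) i 0),
    forall i, is_derive t 1 (fun s => w s i 0)
      ((- (nu2 *: (L *m zeta)) + (nu1 * nu2) *: z t - alpha *: w t) i 0) &
    forall i, is_derive t 1 (fun s => v s i 0) (((alpha * beta) *: (L *m z t)) i 0)]}.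
Proof.
case: traj => _ _ _; apply: lebesgue_aeS => t + t0 => /(_ (ltW t0)).
move=> [[dP dz dv] [[zeta zetaC /esym PE] zE vE]].
have P1 i := is_derive_coord i dP PE.
have z1 i := is_derive_coord i dz zE.
have v1 i := is_derive_coord i dv vE.
exists zeta; split => //; first by rewrite -penalized_costE.
  by move=> i; apply: is_derive_eq (z1 i) _; rewrite /w /residual !mxE; ring.
move=> i; rewrite (_ : (fun s => w s i 0) =
  ((fun s => v s i 0) + (nu2 *: (fun s => P s i 0)) + (alpha *: (fun s => z s i 0))
    + cst (- (nu2 * (Pl * (i == r)%:R))))); last first.
  apply/funext => s; rewrite /w /residual/= !fctE !mxE /GRing.scale/= eqxx andbT; ring.
apply: (is_derive_eq (is_deriveD (is_deriveD (is_deriveD (v1 i) (is_deriveZ nu2 (P1 i)))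
   (is_deriveZ alpha (z1 i))) (is_derive_cst _ _ _))).
by rewrite /w /residual !mxE /GRing.scale/=; ring.
Qed.

Let Pac (T : R) i : 0 <= T -> abs_continuous_on 0 T (fun t => P t i 0).
Proof. by case: traj => Pac _ _ _ T0; apply: abs_continuous_coord; exact: Pac. Qed.

Let zac (T : R) i : 0 <= T -> abs_continuous_on 0 T (fun t => z t i 0).
Proof. by case: traj => _ zac _ _ T0; apply: abs_continuous_coord; exact: zac. Qed.

Let vac (T : R) i : 0 <= T -> abs_continuous_on 0 T (fun t => v t i 0).
Proof. by case: traj => _ _ vac _ T0; apply: abs_continuous_coord; exact: vac. Qed.

Let wac (T : R) i : 0 <= T -> abs_continuous_on 0 T (fun t => w t i 0).
Proof.
move=> T0; rewrite (_ : (fun t => _) = (fun t => v t i 0 + nu2 * P t i 0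
    + alpha * z t i 0 + - (nu2 * (Pl * (i == r)%:R)))); last first.
  by apply/funext => s; rewrite /w /residual/= !mxE eqxx andbT; ring.
apply: abs_continuousD; last exact: abs_continuous_cst.
apply: abs_continuousD; last by apply: abs_continuousZ; exact: zac.
by apply: abs_continuousD; [exact: vac|apply: abs_continuousZ; exact: Pac].
Qed.

Let s t := \sum_i P t i 0 - Pl.
Let m t := \sum_i z t i 0.

(** The derivative vanishes almost everywhere since 1^T L = 0, and absolute continuity makes the sum
    constant; the initial condition in H_0 enters here. *)
Lemma sum_v t : 0 <= t -> \sum_i v t i 0 = 0.
Proof.
move=> t0; suff : `|\sum_i v t i 0 - \sum_i v 0 i 0| <= 0 * (t - 0).
  by rewrite v0 subr0 mul0r normr_le0 => /eqP.
apply: (@abs_continuous_lipschitz _ (fun t => \sum_i v t i 0)) => //.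
  by apply: abs_continuous_sum => i; exact: vac.
apply: lebesgue_aeS flow => u + /andP[u0 _] => /(_ u0)[zeta [_ _ _ _ v1]].
exists 0; last by rewrite normr0.
apply: (is_derive_eq (is_derive_sum_fun v1)).
rewrite (eq_bigr (fun i => (alpha * beta) * (L *m z u) i 0)) => [|i _]; last by rewrite mxE.
by rewrite -mulr_sumr sum_laplacian// mulr0.
Qed.

Lemma sum_residual t : 0 <= t -> \sum_i w t i 0 = nu2 * s t + alpha * m t.
Proof.
move=> t0; rewrite (eq_bigr (fun i => v t i 0 + nu2 * P t i 0 + alpha * z t i 0
    - nu2 * Pl * (i == r)%:R)); last first.
  by move=> i _; rewrite /w /residual !mxE eqxx andbT; ring.
have r1 : \sum_i (i == r)%:R = 1 :> R.
  by rewrite (bigD1 r)//= eqxx big1 ?addr0// => i /negbTE ->.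
rewrite sumrB !big_split/= sum_v// -!mulr_sumr r1.
by rewrite /s /m; ring.
Qed.

(* Left multiplication by 1^T decouples [s' = nu1 m, m' = - alpha m - nu2 s], for
   which the energy below satisfies [E' = - 2 alpha ((nu1 m)^2 + nu1 nu2 s^2)]. *)
Lemma sum_decay : exists2 k : R, 0 < k & exists2 C : R, 0 <= C &
  forall t, 0 <= t -> `|s t| <= C * expR (- k * t) /\ `|m t| <= C * expR (- k * t).
Proof.
pose nu := nu1 * nu2.
have nu0 : 0 < nu by rewrite mulr_gt0.
(* With M = nu1 m, the combination M + alpha s has derivative - nu s, and the products s M coming
   from the three squares cancel. *)
pose E t := (nu1 * m t + alpha * s t) ^+ 2 + (nu1 * m t) ^+ 2 + 2 * nu * s t ^+ 2.
pose K := 5 + 2 * alpha ^+ 2 / nu.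
have K0 : 0 < K.
  have : 0 <= 2 * alpha ^+ 2 / nu by rewrite divr_ge0// ?mulr_ge0// ?sqr_ge0// ltW.
  by rewrite /K; lra.
(* By [EK] the energy decays at rate 2 k; being quadratic, it makes [s] and [m] decay at rate k. *)
pose k := alpha / K.
have k0 : 0 < k by rewrite divr_gt0.
have EK t : E t <= K * ((nu1 * m t) ^+ 2 + nu * s t ^+ 2).
  have -> : K * ((nu1 * m t) ^+ 2 + nu * s t ^+ 2) = 5 * (nu1 * m t) ^+ 2 +
      5 * nu * s t ^+ 2 + 2 * alpha ^+ 2 / nu * (nu1 * m t) ^+ 2
      + 2 * alpha ^+ 2 * s t ^+ 2.
    by rewrite /K; field; rewrite gt_eqF.
  have : 0 <= 2 * alpha ^+ 2 / nu * (nu1 * m t) ^+ 2.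
    by rewrite mulr_ge0 ?sqr_ge0// divr_ge0// ?mulr_ge0// ?sqr_ge0// ltW.
  rewrite /E; have : 0 <= nu * s t ^+ 2 by rewrite mulr_ge0 ?sqr_ge0// ltW.
  have := sqr_ge0 (nu1 * m t - alpha * s t); have := sqr_ge0 (nu1 * m t).
  by move: (nu1 * m t) (nu / 1) => M _; nra.
have sac (T : R) : 0 <= T -> abs_continuous_on 0 T s.
  move=> T0; apply: abs_continuousD; last exact: abs_continuous_cst.
  by apply: abs_continuous_sum => i; exact: Pac.
have mac (T : R) : 0 <= T -> abs_continuous_on 0 T m.
  by move=> T0; apply: abs_continuous_sum => i; exact: zac.
have ED : forall t, 0 <= t -> E t <= E 0 * expR (- (2 * k) * t).
  apply: exp_decay => [T T0|].
    have h1 := abs_continuousZ nu1 (mac T T0).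
    have h2 := abs_continuousD h1 (abs_continuousZ alpha (sac T T0)).
    apply: abs_continuousD; first apply: abs_continuousD.
    - exact: (abs_continuousM h2 h2).
    - exact: (abs_continuousM h1 h1).
    - by apply: abs_continuousZ; exact: (abs_continuousM (sac T T0) (sac T T0)).
  apply: lebesgue_aeS flow => t + t0 => /(_ t0)[zeta [_ P1 z1 _ _]].
  have s1 : is_derive t 1 s (nu1 * m t).
    have := is_deriveB (is_derive_sum_fun P1) (is_derive_cst Pl t 1).
    move/is_derive_eq; apply; rewrite subr0.
    rewrite (eq_bigr (fun i => nu1 * z t i 0 - (L *m zeta) i 0)) => [|i _].
      by rewrite sumrB -mulr_sumr sum_laplacian// subr0.
    by rewrite !mxE addrC.
  have m1 : is_derive t 1 m (- (nu2 * s t) - alpha * m t).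
    apply: (is_derive_eq (is_derive_sum_fun z1)).
    rewrite (eq_bigr (fun i => - beta * (L *m z t) i 0 - w t i 0)) => [|i _].
      by rewrite sumrB -mulr_sumr sum_laplacian// mulr0 sum_residual ?ltW//; ring.
    by rewrite !mxE mulNr.
  have M1 : is_derive t 1 (fun t => nu1 * m t) _ := is_deriveZ nu1 m1.
  have S1 : is_derive t 1 (fun t => alpha * s t) _ := is_deriveZ alpha s1.
  have q1 : is_derive t 1 (fun t => nu1 * m t + alpha * s t) _ := is_deriveD M1 S1.
  have E1 := is_deriveD (is_deriveD (is_deriveM q1 q1) (is_deriveM M1 M1))
    (is_deriveZ (2 * nu) (is_deriveM s1 s1)).
  eexists; first exact: E1.
  rewrite /GRing.scale/=; have := EK t; rewrite -(ler_pM2l k0).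
  have -> : k * (K * ((nu1 * m t) ^+ 2 + nu * s t ^+ 2)) =
      alpha * ((nu1 * m t) ^+ 2 + nu * s t ^+ 2).
    by rewrite mulrA divfK// gt_eqF.
  by rewrite /nu; lra.
(* The summand 1 gives c <= C - 1 <= C^2 for both constants c in front of the squares, which avoids
   square roots. *)
pose C := 1 + E 0 / (2 * nu) + E 0 / nu1 ^+ 2.
have E0 t : 0 <= E t.
  by rewrite /E !addr_ge0 ?sqr_ge0// mulr_ge0 ?sqr_ge0// mulr_ge0// ltW.
have C1 : 0 <= E 0 / (2 * nu) by rewrite divr_ge0// mulr_ge0// ltW.
have C2 : 0 <= E 0 / nu1 ^+ 2 by rewrite divr_ge0// sqr_ge0.
exists k => //; exists C; first by rewrite /C; lra.
move=> t t0.
have d0 := expR_gt0 (- k * t).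
have dd : expR (- (2 * k) * t) = expR (- k * t) ^+ 2.
  by rewrite expr2 -expRD; congr expR; ring.
have bound (x c : R) : 0 <= c -> c <= C - 1 -> x ^+ 2 <= c * expR (- k * t) ^+ 2 ->
    `|x| <= C * expR (- k * t).
  move=> c0 cC xc; rewrite -ler_sqr ?nnegrE ?mulr_ge0//; last by lra.
  rewrite real_normK ?num_real// exprMn; apply: le_trans xc _.
  by rewrite ler_wpM2r ?sqr_ge0//; nra.
have := ED t t0; rewrite dd => Et.
split.
  apply: (bound _ (E 0 / (2 * nu))) => //; first by rewrite /C; lra.
  rewrite mulrAC ler_pdivlMr ?mulr_gt0//; apply: le_trans Et.
  by rewrite /E mulrC lerDr addr_ge0 ?sqr_ge0.
apply: (bound _ (E 0 / nu1 ^+ 2)) => //; first by rewrite /C; lra.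
rewrite mulrAC ler_pdivlMr ?exprn_gt0//; apply: le_trans Et.
have : 0 <= 2 * nu * s t ^+ 2 by rewrite mulr_ge0 ?sqr_ge0// mulr_ge0// ltW.
by have := sqr_ge0 (nu1 * m t + alpha * s t); rewrite /E exprMn; lra.
Qed.

Let F := separable phi.
Let V t := F (P t) + (nu1 * nu2 * dotp (z t) (z t) + dotp (w t) (w t)) / 2.

Let Fac (T : R) : 0 <= T -> abs_continuous_on 0 T (fun t => F (P t)).
Proof.
move=> T0; apply: abs_continuous_sum => i.
have [K K0 PK] := abs_continuous_bounded (Pac i T0).
apply: (abs_continuous_lip (C := phi i (K + 1) + phi i (- K - 1)) _ (Pac i T0)) => a b a0 ab bT.
by apply: convex_real_lip => //; apply: PK; lra.
Qed.

Let Vac (T : R) : 0 <= T -> abs_continuous_on 0 T V.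
Proof.
move=> T0; apply: abs_continuousD; first exact: Fac.
rewrite (_ : (fun t => _) = (fun t => 2^-1 * (nu1 * nu2 * dotp (z t) (z t) + dotp (w t) (w t)))); last first.
  by apply/funext => t; rewrite mulrC.
apply: abs_continuousZ; apply: abs_continuousD; first apply: abs_continuousZ.
  by apply: abs_continuous_sum => i; apply: abs_continuousM; exact: zac.
by apply: abs_continuous_sum => i; apply: abs_continuousM; exact: wac.
Qed.

Let V_ge t : 0 <= F (P t) <= V t.
Proof.
rewrite separable_ge0//= lerDl divr_ge0// addr_ge0 ?dotp_ge0//.
by rewrite mulr_ge0 ?dotp_ge0// mulr_ge0// ltW.
Qed.

(** The subgradient [zeta] is returned with the bound because the optimality gap is later estimated
    with the same [zeta]. *)
Lemma lyapunov_dini : exists2 c : R, 0 < c & exists2 k : R, 0 < k & exists2 C : R, 0 <= C &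
  {ae (@lebesgue_measure R), forall t, 0 < t -> exists zeta,
   [/\ clarke_gradient (separable phi) (P t) zeta,
    (forall i, is_derive t 1 (fun s => P s i 0) ((- (L *m zeta) + nu1 *: z t) i 0)),
    (forall i, is_derive t 1 (fun s => z s i 0) ((- (beta *: (L *m z t)) - w t) i 0)),
    (forall i, is_derive t 1 (fun s => w s i 0)
      ((- (nu2 *: (L *m zeta)) + (nu1 * nu2) *: z t - alpha *: w t) i 0)) &
     left_dini_le V t (- c * (dotp (center zeta) (center zeta) + dotp (z t) (z t)
       + dotp (w t) (w t)) + C * expR (- k * t))]}.
Proof.
have [c c0 diss] := dissipation r A_ge0 A_connected A_balanced alpha_gt0 beta_gt0
  nu1_gt0 nu2_gt0 gains.
have [k k0 [D D0 decay]] := sum_decay.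
pose K := `|Pl| + D.
have K0 : 0 <= K by rewrite addr_ge0.
pose C1 := \sum_i (phi i (K + 1) + phi i (- K - 1)).
have C10 : 0 <= C1 by apply: sumr_ge0 => i _; rewrite addr_ge0//; exact: phi_ge0.
exists (c / 2); first lra.
exists k => //.
(* With x = expR (- k * t), the sum of z is at most D x and the mean of zeta at most C1 + |zeta~|.
   The part C1 gives [nu1 * C1 * D]. Young splits nu1 |zeta~| D x into c |zeta~|^2 / 2, whence the
   rate [c / 2], and nu1^2 D^2 x^2 / (2 c). The squared sum gives c D^2 x^2, and x^2 <= x. *)
exists (nu1 * C1 * D + (nu1 ^+ 2 / (2 * c) + c) * D ^+ 2).
  rewrite addr_ge0// ?mulr_ge0 ?sqr_ge0 ?(ltW nu1_gt0)// addr_ge0 ?(ltW c0)//.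
  by rewrite divr_ge0 ?sqr_ge0// mulr_ge0// ltW.
apply: lebesgue_aeS flow => t + t0 => /(_ t0)[zeta [zetaC P1 z1 w1 _]].
exists zeta; split => //.
set x := expR (- k * t).
have x0 : 0 < x by exact: expR_gt0.
have x1 : x <= 1 by rewrite -expR0 ler_expR mulNr oppr_le0 mulr_ge0// ltW.
have [sx mx] := decay t (ltW t0); rewrite -/x in sx mx.
have meanb : `|mean zeta| <= C1 + enorm (center zeta).
  apply: (clarke_mean_le r phi_ge0 phi_convex K0 _ zetaC).
  have -> : \sum_i P t i 0 = s t + Pl by rewrite subrK.
  by apply: le_trans (ler_normD _ _) _; rewrite addrC lerD2l; nra.
(* [zeta] stays frozen at its value at time [t]: the subgradient inequality at [P t] compares the
   cost with [dotp zeta (P s)], which is differentiable at [t]. *)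
have Fd : left_dini_le (fun t => F (P t)) t (dotp zeta (- (L *m zeta) + nu1 *: z t)).
  apply: (@left_dini_le_dominated _ _ (fun s => dotp zeta (P s))) => [u ut|].
    have := @clarke_gradient_subgradient _ _ _ phi_ge0 phi_convex (P t) (P u) _ zetaC.
    by rewrite dotpDr dotpNr -/F; lra.
  apply: is_derive_left_dini.
  have zc i : is_derive t 1 (fun=> zeta i 0) ((0 : 'cV[R]_n) i 0).
    by rewrite mxE; exact: is_derive_cst.
  apply: (is_derive_eq (is_derive_dotp zc P1)).
  by rewrite dotpE trmx0 mul0mx mxE add0r.
set dz := - (beta *: (L *m z t)) - w t in z1 *.
set dw := - (nu2 *: (L *m zeta)) + (nu1 * nu2) *: z t - alpha *: w t in w1 *.
have Qd : is_derive t 1 (fun t => (nu1 * nu2 * dotp (z t) (z t) + dotp (w t) (w t)) / 2)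
    (nu1 * nu2 * dotp (z t) dz + dotp (w t) dw).
  have zz := is_derive_dotp z1 z1; have ww := is_derive_dotp w1 w1.
  rewrite (_ : (fun t => _) = 2^-1 *: ((nu1 * nu2) *: (fun t => dotp (z t) (z t))
      + (fun t => dotp (w t) (w t)))); last first.
    by apply/funext => u; rewrite !fctE /GRing.scale/= mulrC.
  apply: (is_derive_eq (is_deriveZ _ (is_deriveD (is_deriveZ _ zz) ww))).
  by rewrite /GRing.scale/= (dotpC dz) (dotpC dw); field.
apply: left_dini_leW (left_dini_leD Fd (is_derive_left_dini Qd)).
have := diss zeta (z t) (w t); rewrite -/dz -/dw -/(m t).
move: sx mx meanb (sqr_enorm (center zeta)) (enorm_ge0 (center zeta)).
move: (enorm _) (dotp (center zeta) _) (dotp (z t) (z t)) (dotp (w t) (w t))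
  (dotp_ge0 (z t)) (dotp_ge0 (w t)) => y a b d b0 d0 _ mx meanb ya y0.
rewrite [X in _ -> X <= _]addrA; set lhs := dotp zeta _ + _ + _.
move: lhs (mean zeta) (m t) mx meanb => lhs mz mt mx meanb.
move=> /le_trans; apply.
have mm : nu1 * mz * mt <= nu1 * ((C1 + y) * (D * x)).
  rewrite -mulrA ler_wpM2l ?(ltW nu1_gt0)//; apply: le_trans (ler_norm _) _.
  by rewrite normrM ler_pM.
have mt2 : mt ^+ 2 <= D ^+ 2 * x.
  rewrite -[mt ^+ 2]real_normK ?num_real//.
  apply: (@le_trans _ _ ((D * x) ^+ 2)); first by rewrite ler_sqr ?nnegrE ?mulr_ge0// ltW.
  by rewrite exprMn ler_wpM2l ?sqr_ge0// expr2 ger_pMr.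
have yx : nu1 * (y * (D * x)) <= c / 2 * y ^+ 2 + nu1 ^+ 2 / (2 * c) * D ^+ 2 * x.
  have : 0 <= (2 * c)^-1 * (c * y - nu1 * (D * x)) ^+ 2.
    by rewrite mulr_ge0 ?sqr_ge0// invr_ge0 mulr_ge0// ltW.
  have -> : (2 * c)^-1 * (c * y - nu1 * (D * x)) ^+ 2 =
    c / 2 * y ^+ 2 - nu1 * (y * (D * x)) + nu1 ^+ 2 / (2 * c) * (D ^+ 2 * (x * x)).
    by field; rewrite gt_eqF.
  have : nu1 ^+ 2 / (2 * c) * (D ^+ 2 * (x * x)) <= nu1 ^+ 2 / (2 * c) * (D ^+ 2 * x).
    rewrite ler_wpM2l ?divr_ge0 ?sqr_ge0 ?mulr_ge0 ?(ltW c0)//.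
    by rewrite ler_wpM2l ?sqr_ge0// ger_pMr.
  by lra.
have cmt : c * mt ^+ 2 <= c * (D ^+ 2 * x) by rewrite ler_wpM2l// ltW.
have cb : 0 <= c * b by rewrite mulr_ge0// ltW.
have cd : 0 <= c * d by rewrite mulr_ge0// ltW.
rewrite -ya; move: yx; set N := nu1 ^+ 2 / _ => yx.
by lra.
Qed.

(** All parts of V are nonnegative, so each is bounded with V. The costs alone need not confine P;
    the penalty does, since the excess of each coordinate over the box is at most [eps * V0]. *)
Lemma trajectory_bounded : exists2 B : R, 0 <= B & forall t, 0 <= t -> forall i,
  [/\ `|P t i 0| <= B, `|z t i 0| <= B & `|w t i 0| <= B].
Proof.
have [c c0 [k k0 [C C0 VD]]] := lyapunov_dini.
have Vb : forall t, 0 <= t -> V t <= V 0 + C / k.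
  apply: perturbed_lyapunov_bounded => //.
  apply: lebesgue_aeS VD => t + t0 => /(_ t0)[zeta [_ _ _ _]].
  apply: left_dini_leW; rewrite gerDr mulNr oppr_le0 mulr_ge0 ?(ltW c0)//.
  by rewrite !addr_ge0 ?dotp_ge0.
set V0 := V 0 + C / k in Vb.
have V00 : 0 <= V0.
  by apply: le_trans (Vb 0 (lexx _)); have /andP[F0 /(le_trans F0)] := V_ge 0.
pose W := eps * V0 + 2 * V0 / (nu1 * nu2) + 2 * V0 + 1.
have nn : 0 < nu1 * nu2 by rewrite mulr_gt0.
have W1 : 0 <= eps * V0 by rewrite mulr_ge0// ltW.
have W2 : 0 <= 2 * V0 / (nu1 * nu2) by rewrite divr_ge0 ?mulr_ge0// ltW.
pose B := W + \sum_i (`|Pm i 0| + `|PM i 0|).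
have BW : W <= B by rewrite lerDl; apply: sumr_ge0 => i _; rewrite addr_ge0.
(* Since W - 1 <= W^2, a bound on the square yields one on the absolute value without square
   roots. *)
have sqW (x : R) : x ^+ 2 <= W - 1 -> `|x| <= B.
  move=> xW; apply: le_trans BW; rewrite -ler_sqr ?nnegrE//; last by rewrite /W; lra.
  rewrite real_normK ?num_real//; have : 0 <= W - 1 by rewrite /W; lra.
  by move: xW; nra.
exists B => [|t t0 i]; first by apply: le_trans BW; rewrite /W; lra.
have Vt := Vb t t0; have /andP[F0 FV] := V_ge t.
have z0 := dotp_ge0 (z t); have w0 := dotp_ge0 (w t).
have nz0 : 0 <= nu1 * nu2 * dotp (z t) (z t) by rewrite mulr_ge0// ltW.
have FtV : F (P t) <= V0 by lra.
split.
- have phiV : phi i (P t i 0) <= V0.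
    apply: le_trans FtV; rewrite /F /separable (bigD1 i)//= lerDl.
    by apply: sumr_ge0 => j _; exact: phi_ge0.
  have pen : Num.max 0 (P t i 0 - PM i 0) + Num.max 0 (Pm i 0 - P t i 0) <= eps * V0.
    rewrite -ler_pdivrMl//; apply: le_trans phiV; rewrite /phi /penalized_summand.
    by rewrite lerDr.
  have : P t i 0 - PM i 0 <= Num.max 0 (P t i 0 - PM i 0) by rewrite le_max lexx orbT.
  have : Pm i 0 - P t i 0 <= Num.max 0 (Pm i 0 - P t i 0) by rewrite le_max lexx orbT.
  have : 0 <= Num.max 0 (P t i 0 - PM i 0) by rewrite le_max lexx.
  have : 0 <= Num.max 0 (Pm i 0 - P t i 0) by rewrite le_max lexx.
  have : W + (`|Pm i 0| + `|PM i 0|) <= B.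
    rewrite /B (bigD1 i)//= lerD2l lerDl; apply: sumr_ge0 => j _; exact: addr_ge0.
  have := ler_norm (PM i 0); have := ler_norm (- Pm i 0); rewrite normrN.
  have : 0 <= `|Pm i 0| by []; have : 0 <= `|PM i 0| by [].
  by rewrite ler_norml /W; lra.
- apply: sqW; apply: le_trans (sqr_coord_le_dotp _ _) _.
  have : dotp (z t) (z t) <= 2 * V0 / (nu1 * nu2).
    rewrite ler_pdivlMr// mulrC; move: Vt; rewrite /V; lra.
  by rewrite /W; lra.
- apply: sqW; apply: le_trans (sqr_coord_le_dotp _ _) _.
  by move: Vt; rewrite /V /W; lra.
Qed.

Let subgradient_bound (B : R) : 0 <= B -> exists2 C : R, 0 <= C & forall t zeta,
  (forall i, `|P t i 0| <= B) -> clarke_gradient (separable phi) (P t) zeta ->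
  forall i, `|zeta i 0| <= C.
Proof.
move=> B0; exists (\sum_i (phi i (B + 1) + phi i (- B - 1))).
  by apply: sumr_ge0 => i _; rewrite addr_ge0//; exact: phi_ge0.
move=> t zeta PB zetaC i; rewrite (bigD1 i)//=.
have : 0 <= \sum_(j < n | j != i) (phi j (B + 1) + phi j (- B - 1)).
  by apply: sumr_ge0 => j _; rewrite addr_ge0//; exact: phi_ge0.
have : 0 <= phi i (B + 1) by exact: phi_ge0.
have : 0 <= phi i (- B - 1) by exact: phi_ge0.
have /andP[PB1 PB2] : - B <= P t i 0 <= B by rewrite -ler_norml.
have zle : zeta i 0 <= phi i (B + 1) := clarke_gradient_le phi_ge0 phi_convex zetaC PB2.
have zge : - phi i (- B - 1) <= zeta i 0 := clarke_gradient_ge phi_ge0 phi_convex zetaC PB1.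
by rewrite ler_norml; lra.
Qed.

(** On a bounded trajectory the subgradients are bounded, hence so are all right-hand sides of
    [flow]; this is the uniform continuity that Barbalat's argument requires. *)
Lemma trajectory_lipschitz : exists2 M : R, 0 < M & forall a b, 0 <= a -> a <= b ->
  forall i, [/\ `|P b i 0 - P a i 0| <= M * (b - a),
    `|z b i 0 - z a i 0| <= M * (b - a) & `|w b i 0 - w a i 0| <= M * (b - a)].
Proof.
have [B B0 PB] := trajectory_bounded.
have [C C0 zetaB] := subgradient_bound B0.
pose S := \sum_i \sum_j `|L i j|.
have S0 : 0 <= S by apply: sumr_ge0 => i _; exact: sumr_ge0.
have SC : 0 <= S * C by rewrite mulr_ge0.
have SB : 0 <= S * B by rewrite mulr_ge0.
have nn : 0 < nu1 * nu2 by rewrite mulr_gt0.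
pose M := (1 + nu2) * (S * C) + beta * (S * B) + (nu1 + 1 + nu1 * nu2 + alpha) * B + 1.
have b1 : 0 <= beta * (S * B) by rewrite mulr_ge0// ltW.
have b2 : 0 <= nu2 * (S * C) by rewrite mulr_ge0// ltW.
have b3 : 0 <= nu1 * B by rewrite mulr_ge0// ltW.
have b4 : 0 <= nu1 * nu2 * B by rewrite mulr_ge0// ltW.
have b5 : 0 <= alpha * B by rewrite mulr_ge0// ltW.
exists M; first by rewrite /M; lra.
move=> a b a0 ab i.
have sub (x : R -> R) : (forall T : R, 0 <= T -> abs_continuous_on 0 T x) ->
    abs_continuous_on a b x.
  by move=> xac; exact: (abs_continuous_sub a0 (lexx b) (xac b (le_trans a0 ab))).
have scale (k x y : R) : 0 <= k -> `|x| <= y -> `|k * x| <= k * y.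
  by move=> k0 xy; rewrite normrM ger0_norm// ler_wpM2l.
have nrm3 (x y u : R) : `|x + y + u| <= `|x| + `|y| + `|u|.
  by apply: le_trans (ler_normD _ _) _; rewrite lerD2r ler_normD.
split.
- apply: (abs_continuous_lipschitz (x := fun t => P t i 0)) => //.
    by apply: sub => T T0; exact: Pac.
  apply: lebesgue_aeS flow => t + /andP[at_ _] => /(_ (le_lt_trans a0 at_)).
  have tge0 : (0 : R) <= t := le_trans a0 (ltW at_).
  have Pt j := PB t tge0 j.
  move=> [zeta [zetaC P1 _ _ _]]; exists ((- (L *m zeta) + nu1 *: z t) i 0) => //.
  have [_ zB _] := Pt i.
  move: (mulmx_coord_le L i C0 (zetaB t zeta (fun j => let: And3 h _ _ := Pt j in h) zetaC)).
  have := scale _ _ _ (ltW nu1_gt0) zB.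
  rewrite -/S; move: (L *m zeta) (z t) => y zt; rewrite !mxE.
  by have := ler_normD (- y i 0) (nu1 * zt i 0); rewrite normrN /M; lra.
- apply: (abs_continuous_lipschitz (x := fun t => z t i 0)) => //.
    by apply: sub => T T0; exact: zac.
  apply: lebesgue_aeS flow => t + /andP[at_ _] => /(_ (le_lt_trans a0 at_)).
  have tge0 : (0 : R) <= t := le_trans a0 (ltW at_).
  have Pt j := PB t tge0 j.
  move=> [zeta [zetaC _ z1 _ _]]; exists ((- (beta *: (L *m z t)) - w t) i 0) => //.
  have Lz := mulmx_coord_le L i B0 (fun j => let: And3 _ h _ := Pt j in h).
  have [_ _ wB] := Pt i.
  move: (scale _ _ _ (ltW beta_gt0) Lz) wB.
  rewrite -/S; move: (L *m z t) (w t) => y wt; rewrite !mxE.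
  by have := ler_normD (- (beta * y i 0)) (- wt i 0); rewrite !normrN /M; lra.
- apply: (abs_continuous_lipschitz (x := fun t => w t i 0)) => //.
    by apply: sub => T T0; exact: wac.
  apply: lebesgue_aeS flow => t + /andP[at_ _] => /(_ (le_lt_trans a0 at_)).
  have tge0 : (0 : R) <= t := le_trans a0 (ltW at_).
  have Pt j := PB t tge0 j.
  move=> [zeta [zetaC _ _ w1 _]].
  exists ((- (nu2 *: (L *m zeta)) + (nu1 * nu2) *: z t - alpha *: w t) i 0) => //.
  have Lz := mulmx_coord_le L i C0 (zetaB t zeta (fun j => let: And3 h _ _ := Pt j in h) zetaC).
  have [_ zB wB] := Pt i.
  move: (scale _ _ _ (ltW nu2_gt0) Lz) (scale _ _ _ (ltW alpha_gt0) wB) (scale _ _ _ (ltW nn) zB).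
  rewrite -/S; move: (L *m zeta) (z t) (w t) => y zt wt; rewrite !mxE.
  have := nrm3 (- (nu2 * y i 0)) (nu1 * nu2 * zt i 0) (- (alpha * wt i 0)).
  by rewrite !normrN /M; lra.
Qed.

Lemma trajectory_z_cvg0 i : z t i 0 @[t --> +oo] --> (0 : R).
Proof.
have [c c0 [k k0 [C C0 VD]]] := lyapunov_dini.
have [M M0 lip] := trajectory_lipschitz.
apply: (@perturbed_barbalat _ V C k C0 k0 Vac (fun t => z t i 0) c M) => //.
- by move=> t t0; have /andP[F0 /(le_trans F0)] := V_ge t.
- by move=> a b a0 ab; case: (lip a b a0 ab i).
- apply: lebesgue_aeS VD => t + t0 => /(_ t0)[zeta [_ _ _ _]]; apply: left_dini_leW.
  rewrite lerD2r !mulNr lerN2 ler_wpM2l ?(ltW c0)//.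
  have := sqr_coord_le_dotp (z t) i; have := dotp_ge0 (w t).
  by have := dotp_ge0 (center zeta); lra.
Qed.

Lemma trajectory_w_cvg0 i : w t i 0 @[t --> +oo] --> (0 : R).
Proof.
have [c c0 [k k0 [C C0 VD]]] := lyapunov_dini.
have [M M0 lip] := trajectory_lipschitz.
apply: (@perturbed_barbalat _ V C k C0 k0 Vac (fun t => w t i 0) c M) => //.
- by move=> t t0; have /andP[F0 /(le_trans F0)] := V_ge t.
- by move=> a b a0 ab; case: (lip a b a0 ab i).
- apply: lebesgue_aeS VD => t + t0 => /(_ t0)[zeta [_ _ _ _]]; apply: left_dini_leW.
  rewrite lerD2r !mulNr lerN2 ler_wpM2l ?(ltW c0)//.
  have := sqr_coord_le_dotp (w t) i; have := dotp_ge0 (z t).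
  by have := dotp_ge0 (center zeta); lra.
Qed.

Lemma penalized_summand_box (S : 'cV[R]_n) i : Pm i 0 <= S i 0 <= PM i 0 -> phi i (S i 0) = f i (S i 0).
Proof.
move=> /andP[S1 S2]; rewrite /phi /penalized_summand !max_l ?subr_le0//.
by rewrite addr0 mulr0 addr0.
Qed.

(* By convexity the optimality gap is at most [zeta . (P - S)], which the centered
   part of zeta and the decaying sum of P - S control. *)
Lemma trajectory_gap_cvg0 S : ED_feasible Pl Pm PM S ->
  Num.max 0 (penalized_cost f Pm PM eps (P t) - total_cost f S) @[t --> +oo] --> (0 : R).
Proof.
move=> [bS SPl]; rewrite penalized_costE -/phi -/F.
have FS : total_cost f S = F S by apply: eq_bigr => i _; rewrite penalized_summand_box.
rewrite FS; pose q t := Num.max 0 (F (P t) - F S); rewrite -/(q _).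
have [c c0 [k k0 [C C0 VD]]] := lyapunov_dini.
have [M M0 lip] := trajectory_lipschitz.
have [B B0 PB] := trajectory_bounded.
have [D D0 zetaB] := subgradient_bound B0.
have [k' k'0 [E E0 decay]] := sum_decay.
pose kk := Num.min k k'.
have kk0 : 0 < kk by rewrite lt_min k0 k'0.
have n0 : (0 < n)%N by exact: leq_ltn_trans (ltn_ord r).
(* With y = |zeta~|, [N * y] bounds zeta~ . (P - S): there are n products of a factor at most y and
   one at most [B + |S|]. The 1 keeps [N] positive. *)
pose N := n%:R * (B + `|S|) + 1.
have N0 : 0 < N by rewrite ltr_wpDl// mulr_ge0// addr_ge0.
pose Mq := (\sum_i (phi i (B + 1) + phi i (- B - 1))) * M + 1.
have Mq0 : 0 < Mq.
  rewrite ltr_wpDl// mulr_ge0 ?(ltW M0)//; apply: sumr_ge0 => i _.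
  by rewrite addr_ge0//; exact: phi_ge0.
(* With x = expR (- kk * t), the gap is at most N y + D E x, so its square is at most 2 N^2 y^2 + 2
   (D E x)^2. Multiplied by [c / (2 * N ^+ 2)] this is c y^2 plus a decaying term, which joins the
   perturbation. *)
pose C' := C + c * D ^+ 2 * E ^+ 2 / N ^+ 2.
have C'0 : 0 <= C' by rewrite addr_ge0// divr_ge0 ?sqr_ge0// !mulr_ge0 ?sqr_ge0// ltW.
have c'0 : 0 < c / (2 * N ^+ 2) by rewrite divr_gt0// mulr_gt0// exprn_gt0.
apply: (@perturbed_barbalat _ V C' kk C'0 kk0 Vac q (c / (2 * N ^+ 2)) Mq) => //.
- by move=> t t0; have /andP[F0 /(le_trans F0)] := V_ge t.
- move=> a b a0 ab; apply: le_trans (max0_contract _ _) _.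
  have -> : F (P b) - F S - (F (P a) - F S) = F (P b) - F (P a) by ring.
  apply: le_trans (separable_lip phi_ge0 phi_convex (K := B) _ _) _ => [i|i|].
  + by case: (PB b (le_trans a0 ab) i).
  + by case: (PB a a0 i).
  apply: (@le_trans _ _ (\sum_i (phi i (B + 1) + phi i (- B - 1)) * (M * (b - a)))).
    apply: ler_sum => i _; rewrite ler_wpM2l//; last by case: (lip a b a0 ab i).
    by rewrite addr_ge0//; exact: phi_ge0.
  by rewrite -mulr_suml mulrA ler_wpM2r ?subr_ge0// lerDl.
apply: lebesgue_aeS VD => t + t0 => /(_ t0)[zeta [zetaC _ _ _]].
have tge0 : (0 : R) <= t := ltW t0.
have zB := zetaB t zeta (fun i => let: And3 h _ _ := PB t tge0 i in h) zetaC.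
apply: left_dini_leW.
have meanD : `|mean zeta| <= D.
  rewrite /mean normrM normfV normr_nat ler_pdivrMr ?ltr0n//.
  apply: le_trans (ler_norm_sum _ _ _) _.
  by apply: le_trans (ler_sum _ (fun i _ => zB i)) _; rewrite sumr_const card_ord mulr_natr.
pose y := enorm (center zeta).
have y0 : 0 <= y := enorm_ge0 _.
pose x := expR (- kk * t).
have x0 : 0 < x := expR_gt0 _.
have xk : expR (- k * t) <= x.
  by rewrite ler_expR ler_wpM2r// lerN2 ge_min lexx.
have xk' : expR (- k' * t) <= x.
  by rewrite ler_expR ler_wpM2r// lerN2 ge_min lexx orbT.
have x1 : x <= 1 by rewrite -expR0 ler_expR mulNr oppr_le0 mulr_ge0// ltW.
have sx : `|s t| <= E * x.
  by have [sE _] := decay t tge0; apply: le_trans sE _; rewrite ler_wpM2l.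
have qle : q t <= N * y + D * (E * x).
  rewrite ge_max; apply/andP; split.
    by rewrite addr_ge0// ?mulr_ge0// ltW.
  have := @clarke_gradient_subgradient _ _ _ phi_ge0 phi_convex (P t) S _ zetaC.
  rewrite -/F -opprB dotpNr dotp_center_mean => h.
  have -> : F (P t) - F S = - (F S - F (P t)) by ring.
  rewrite lerNl; apply: le_trans h; rewrite lerN2.
  have -> : \sum_i (P t - S) i 0 = s t.
    rewrite (eq_bigr (fun i => P t i 0 - S i 0)) => [|i _]; last by rewrite !mxE.
    by rewrite sumrB SPl.
  apply: lerD; last first.
    apply: le_trans (ler_norm _) _; rewrite normrM; apply: ler_pM => //.
  apply: (@le_trans _ _ (\sum_(i < n) y * (B + `|S|))).
    apply: ler_sum => i _; apply: le_trans (ler_norm _) _; rewrite normrM.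
    apply: ler_pM => //; first exact: coord_le_enorm.
    rewrite !mxE; apply: le_trans (ler_normB _ _) _; apply: lerD; last exact: coord_le_norm.
    by case: (PB t tge0 i).
  by rewrite sumr_const card_ord -mulr_natl mulrCA mulrC ler_wpM2r// lerDl.
have q0 : 0 <= q t by rewrite le_max lexx.
have q2 : q t ^+ 2 <= 2 * N ^+ 2 * y ^+ 2 + 2 * (D * (E * x)) ^+ 2.
  have : q t ^+ 2 <= (N * y + D * (E * x)) ^+ 2.
    by rewrite ler_sqr ?nnegrE// (le_trans q0 qle).
  by have := sqr_ge0 (N * y - D * (E * x)); lra.
have x2 : x ^+ 2 <= x by rewrite expr2 ger_pMr.
have key : c / (2 * N ^+ 2) * q t ^+ 2 <= c * y ^+ 2 + c * D ^+ 2 * E ^+ 2 / N ^+ 2 * x.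
  apply: (@le_trans _ _ (c / (2 * N ^+ 2) * (2 * N ^+ 2 * y ^+ 2 + 2 * (D * (E * x)) ^+ 2))).
    by rewrite ler_wpM2l// ltW.
  have -> : c / (2 * N ^+ 2) * (2 * N ^+ 2 * y ^+ 2 + 2 * (D * (E * x)) ^+ 2) =
    c * y ^+ 2 + c * D ^+ 2 * E ^+ 2 / N ^+ 2 * x ^+ 2.
    by field; rewrite gt_eqF.
  by rewrite lerD2l ler_wpM2l// divr_ge0 ?sqr_ge0// !mulr_ge0 ?sqr_ge0// ltW.
rewrite -(sqr_enorm (center zeta)) -/y -/x.
have b0 : 0 <= c * dotp (z t) (z t) by rewrite mulr_ge0 ?dotp_ge0// ltW.
have d0 : 0 <= c * dotp (w t) (w t) by rewrite mulr_ge0 ?dotp_ge0// ltW.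
have Cx : C * expR (- k * t) <= C * x by rewrite ler_wpM2l.
rewrite /C'; move: key.
move: (c / (2 * N ^+ 2)) (c * D ^+ 2 * E ^+ 2 / N ^+ 2) => G H key.
by lra.
Qed.

Lemma trajectory_sum_cvg0 : \sum_i P t i 0 - Pl @[t --> +oo] --> (0 : R).
Proof.
have [k k0 [C C0 decay]] := sum_decay.
apply/cvgrPdist_lt => e e0; near=> t.
have t0 : 0 <= t by near: t; apply: nbhs_pinfty_ge; exact: num_real.
(* This threshold suffices because expR (k t) >= 1 + k t > C / e. *)
have te : C / (e * k) < t by near: t; apply: nbhs_pinfty_gt; exact: num_real.
rewrite sub0r normrN; have [st _] := decay t t0; apply: le_lt_trans st _.
rewrite mulNr expRN ltr_pdivrMr ?expR_gt0//.
have := expR_ge1Dx (k * t); rewrite ltr_pdivrMr ?mulr_gt0// in te.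
by nra.
Unshelve. all: by end_near. Qed.

End Trajectory.

(** * Distance to the set of equilibria *)

Lemma edist_le_norm (R : realType) n (a b : 'cV[R]_n * 'cV[R]_n * 'cV[R]_n) (e : R) :
  0 < e -> `|a.1.1 - b.1.1| < e -> `|a.1.2 - b.1.2| < e -> `|a.2 - b.2| < e ->
  (edist (a, b) <= e%:E)%E.
Proof.
move=> e0 h1 h2 h3; apply: edist_fin => //.
by split; [split|] => /=; rewrite -ball_normE.
Qed.

Theorem theorem5p2 (R : realType) (n : nat)
    (A : 'M[R]_n)
    (A_ge0 : forall i j, 0 <= A i j)
    (A_connected : strongly_connected A)
    (A_balanced : weight_balanced A)
    (f : 'I_n -> R -> R)
    (f_ge0 : forall i x, 0 <= f i x)
    (f_convex : forall i, @convex_function R R^o setT (f i))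
    (f_C1 : forall i, C1_function (f i))
    (Pl : R) (Pl_gt0 : 0 < Pl)
    (Pm PM : 'cV[R]_n)
    (feasible_nonempty : ED_feasible Pl Pm PM !=set0)
    (Pm_infeasible : ~ ED_feasible Pl Pm PM Pm)
    (PM_infeasible : ~ ED_feasible Pl Pm PM PM)
    (r : 'I_n)
    (eps : R) (eps_gt0 : 0 < eps)
    (* inverse in the extended reals: no upper bound on eps if the maximum is 0 *)
    (eps_small : (eps%:E < ((2 * max_gradient_norm f Pl Pm PM)%:E)^-1)%E)
    (alpha beta nu1 nu2 : R)
    (alpha_gt0 : 0 < alpha) (beta_gt0 : 0 < beta)
    (nu1_gt0 : 0 < nu1) (nu2_gt0 : 0 < nu2)
    (gains :
      let L := laplacian A in
      nu1 / (beta * nu2 * lambda2 (L + L^T))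
        + nu2 ^+ 2 * lambda_max (L^T *m L) / (2 * alpha)
      < lambda2 (L + L^T))
    (P z v : R -> 'cV[R]_n)
    (v0 : \sum_i v 0 i 0 = 0)
    (traj : trajectory (laplacian A) f Pl Pm PM eps r alpha beta nu1 nu2 P z v) :
  edist_inf (F_aug f Pl Pm PM r nu2) (P t, z t, v t) @[t --> +oo] --> 0%E.
Proof.
have fc i : convex_real (f i) by exact: convex_function_real.
have fd i x : derivable (f i) x 1 by case: (f_C1 i).
have [S0 S0sol] := ED_solutions_nonempty f_ge0 fc feasible_nonempty.
have [B B0 PB] := trajectory_bounded A_ge0 A_connected A_balanced f_ge0 fc eps_gt0
  alpha_gt0 beta_gt0 nu1_gt0 nu2_gt0 gains v0 traj.
have zc := trajectory_z_cvg0 A_ge0 A_connected A_balanced f_ge0 fc eps_gt0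
  alpha_gt0 beta_gt0 nu1_gt0 nu2_gt0 gains v0 traj.
have wc := trajectory_w_cvg0 A_ge0 A_connected A_balanced f_ge0 fc eps_gt0
  alpha_gt0 beta_gt0 nu1_gt0 nu2_gt0 gains v0 traj.
have gc := trajectory_gap_cvg0 A_ge0 A_connected A_balanced f_ge0 fc eps_gt0
  alpha_gt0 beta_gt0 nu1_gt0 nu2_gt0 gains v0 traj S0sol.1.
have sc := trajectory_sum_cvg0 A_balanced alpha_gt0 nu1_gt0 nu2_gt0 v0 traj.
have close (e : R) : 0 < e -> \forall t \near +oo,
    (edist_inf (F_aug f Pl Pm PM r nu2) (P t, z t, v t) <= e%:E)%E.
  (* The distance of v to its target is that of w - alpha z - nu2 (P - S) to 0, at most (1 + alpha +
     nu2) eta; the factor 3 leaves room for strict inequalities. *)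
  move=> e0; pose eta := e / (3 * (1 + alpha + nu2)).
  have anu : 0 < 1 + alpha + nu2 by rewrite !addr_gt0.
  have eta0 : 0 < eta by rewrite divr_gt0// mulr_gt0.
  have etaE : e = eta * (3 * (1 + alpha + nu2)) by rewrite divfK// gt_eqF// mulr_gt0.
  have [delta delta0 near_sol] := near_ED_solutions f_ge0 fc fd feasible_nonempty
    eps_gt0 eps_small r eta0 B0 S0sol.
  near=> t.
  have t0 : 0 <= t by near: t; apply: nbhs_pinfty_ge; exact: num_real.
  have Pt : `|P t| <= B by apply: norm_le_coord => // i; case: (PB t t0 i).
  have zt : `|z t| <= eta.
    apply: norm_le_coord; first exact: ltW.
    near: t; apply: filter_forall => i.
    move/cvgrPdist_le : (zc i) => /(_ _ eta0); apply: filterS => t.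
    by rewrite sub0r normrN.
  have wt : `|residual Pl r alpha nu2 P z v t| <= eta.
    apply: norm_le_coord; first exact: ltW.
    near: t; apply: filter_forall => i.
    move/cvgrPdist_le : (wc i) => /(_ _ eta0); apply: filterS => t.
    by rewrite sub0r normrN.
  have st : `|\sum_i P t i 0 - Pl| < delta.
    near: t; move/cvgrPdist_lt : sc => /(_ _ delta0); apply: filterS => t.
    by rewrite sub0r normrN.
  have gt_ : Num.max 0 (penalized_cost f Pm PM eps (P t) - total_cost f S0) < delta.
    near: t; move/cvgrPdist_lt : gc => /(_ _ delta0); apply: filterS => t.
    by rewrite sub0r normrN => /ltr_normlW.
  (* The solution [S] depends on [t]: the trajectory approaches the set, not a chosen point of
     it. *)
  have [S Ssol PS] := near_sol _ Pt st gt_.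
  have eta3 : eta < e.
    by rewrite etaE ltr_pMr//; move: alpha_gt0 nu2_gt0; lra.
  apply: (@le_trans _ _ (edist ((P t, z t, v t), (S, 0, mismatch Pl r nu2 S)))).
    by apply: ereal_inf_lbound; exists (S, 0, mismatch Pl r nu2 S).
  apply: edist_le_norm => //=.
  - exact: lt_trans PS eta3.
  - by rewrite subr0; exact: le_lt_trans zt eta3.
  have -> : v t - mismatch Pl r nu2 S =
      residual Pl r alpha nu2 P z v t - alpha *: z t - nu2 *: (P t - S).
    by apply/matrixP => i j; rewrite !mxE; ring.
  apply: le_lt_trans (ler_normB _ _) _.
  apply: (@le_lt_trans _ _ (eta + alpha * eta + nu2 * eta)).
    apply: lerD; last first.
      by rewrite normrZ gtr0_norm// ler_wpM2l ?(ltW PS)// ltW.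
    apply: le_trans (ler_normB _ _) _; apply: lerD => //.
    by rewrite normrZ gtr0_norm// ler_wpM2l// ltW.
  rewrite etaE (_ : eta + alpha * eta + nu2 * eta = eta * (1 + alpha + nu2)); last by ring.
  by rewrite ltr_pM2l// ltr_pMl// ltr1n.
apply/fine_cvgP; split.
  near=> t; rewrite ge0_fin_numE ?edist_inf_ge0//.
  apply: (@le_lt_trans _ _ 1%:E); last exact: ltry.
  by near: t; exact: close.
apply/cvgrPdist_le => e e0; near=> t; rewrite sub0r normrN.
have te : (edist_inf (F_aug f Pl Pm PM r nu2) (P t, z t, v t) <= e%:E)%E.
  by near: t; exact: close.
have ge0 := edist_inf_ge0 (F_aug f Pl Pm PM r nu2) (P t, z t, v t).
rewrite /= ger0_norm ?fine_ge0// -lee_fin fineK//.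
by rewrite ge0_fin_numE//; apply: le_lt_trans te _; exact: ltry.
Unshelve. all: by end_near. Qed.
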